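(* Assume that conditions (A1), (A2), (A3), (C1), (C2), (C3) and (T) spelled out in the context are fulfilled. For any $K>0$ and any positive integer $n$, denote $x_n=K\sqrt{\log n}$. There exist positive constants $c_1,c_2$ such that for any $K>0$, for $n$ large enough, uniformly in $j\in\{1,\dots,J_n\}$, $\theta_j\in\Theta$ and $f^{[j]}\in F$, $$\mathbf{P}\left(\sqrt{n}\,|\widehat\theta_j-\theta_j|>x_n\,\middle|\,\theta_j\right)\le c_1\exp(-c_2x_n^2).$$
   Context: Model: for $n\ge 1$ and $J_n\ge1$ (an integer depending on $n$), one observes $$Y_{ij}=f^{[j]}(t_i-\theta_j)+\varepsilon_{ij},\qquad t_i=i/n,\ i=1,\dots,n,\ j=1,\dots,J_n,$$ where the $\varepsilon_{ij}$ are i.i.d. standard normal and independent of the $\theta_j$'s, and the $\theta_j$ are i.i.d. random variables with distribution $\mu$ (the noise level is taken to be $1$). $\mathbf P(\cdot\,|\,\theta_j)$ is the conditional probability given $\theta_j$, i.e. the probability when the shift of curve $j$ is fixed at $\theta_j$. Conditions (A). (A1) The support of $\mu$ is contained in $\Theta=\{\theta\in\mathbb R:|\theta|\le\tau_0\}$ with $0<\tau_0<1/4$. (A2) Each function $f$ (here each $f^{[j]}$) is symmetric ($f(x)=f(-x)$), $1$-periodic, with $f(t)=\sqrt2\sum_{k\ge1}f_k\cos(2\pi kt)$, $f_k=\sqrt2\int_0^1f(t)\cos(2\pi kt)\,dt$ (in particular $\int_0^1f=0$). (A3) For fixed $\rho>0$ and $C_0<\infty$, each such $f$ belongs to $F=F(\rho,C_0)$,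 the set of functions $f$ as in (A2) that are in $\mathcal C^2(\mathbb R)$ with $f_1^2\ge\rho$ and $\|f''\|^2\le C_0$, where $\|\cdot\|$ is the $L^2$-norm on $[0,1]$. Weights: $(h_k)_{k\ge1}$ is a sequence of real numbers, allowed to depend on $n$, with $h_1=1$ and $0\le h_k\le1$ for all $k$. There are positive constants $D_1,\rho_1$ (independent of $n$) such that: (C1) only finitely many $h_k$ are nonzero; (C2) $\left[\sum_{k\ge1}(2\pi k)^2h_k^2\right]^{1/2}\ge\rho_1(\log^2n)\max_{k\ge1}(2\pi k)h_k$; (C3) $\sum_{k\ge1}h_k(2\pi k)^4\le D_1n$; (T) as $n\to\infty$, $\left(\sum_{k\ge1}(1-h_k)(2\pi k)^2f_k^2\right)^2=o\left(\sum_{k\ge1}(1-h_k)^2(2\pi k)^2f_k^2\right)$, uniformly over $f\in F$. Estimator: $$\widehat\theta_j\in\operatorname{argmax}_{\tau\in\Theta}\ \sum_{k\ge1}h_k\left(\frac1n\sum_{i=1}^n\cos(2\pi k(t_i-\tau))Y_{ij}\right)^2 .$$ *)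

(* Defs.v *)
From HB Require Import structures.
From mathcomp Require Import all_boot all_order all_algebra.
From mathcomp Require Import all_classical all_reals all_analysis.

Set Implicit Arguments.
Unset Strict Implicit.
Unset Printing Implicit Defensive.

Import Order.TTheory GRing.Theory Num.Theory.
Import numFieldTopology.Exports numFieldNormedType.Exports.

Local Open Scope classical_set_scope.
Local Open Scope ring_scope.

(* All frequency-indexed families are functions of k : nat, of which only the
   values at k >= 1 matter. [sum1 u] is the real limit of the partial sums
   u 1 + ... + u N. Every use below is a convergent series: it has finitely
   many nonzero terms by C1, or it is dominated by the sum of (2 pi k f_k)^2
   for a C^2 function f. *)
Definition sum1 (R : realType) (u : nat -> R) : R :=
  \big[+%R/0]_(1 <= k <oo) u k.

Definition freq (R : realType) (k : nat) : R := 2 * pi * k%:R.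

Definition shift_set (R : realType) (tau0 : R) : set R :=
  [set t | `|t| <= tau0].

Definition supp (R : realType) (mu : probability (measurableTypeR R) R) :
    set R :=
  [set x | forall U : set R, open U -> U x -> (0 < mu U)%E].

Section regularity.
Context (R : realType).
Implicit Types (f : R -> R).

Definition fcoef f (k : nat) : R :=
  Num.sqrt 2 *
  (\int[@lebesgue_measure R]_(t in `[0, 1]) (f t * cos (freq R k * t)))%R.

Definition even_fun f := forall x, f (- x) = f x.

Definition one_periodic f := forall x, f (x + 1) = f x.

Definition cosine_expansion f := forall t,
  (fun N => Num.sqrt 2 * \sum_(1 <= k < N) fcoef f k * cos (freq R k * t))
    @ \oo --> f t.

Definition twice_continuously_differentiable f :=
  [/\ forall x, derivable f x 1,
      forall x, derivable (f^`())%classic x 1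
    & continuous (f^`(2))%classic].

Definition L2normsq f : R :=
  (\int[@lebesgue_measure R]_(t in `[0, 1]) (f t ^+ 2))%R.

Definition class_F (rho C0 : R) : set (R -> R) :=
  [set f | [/\ even_fun f, one_periodic f & cosine_expansion f] /\
           [/\ twice_continuously_differentiable f,
               rho <= fcoef f 1 ^+ 2
             & L2normsq (f^`(2))%classic <= C0]].

End regularity.

Section weights.
Context (R : realType).
(* [h n k] is the weight of frequency k at sample size n. *)
Implicit Types (h : nat -> nat -> R).

Definition weights h := forall n, (1 <= n)%N ->
  h n 1%N = 1 /\ forall k, (1 <= k)%N -> 0 <= h n k <= 1.

Definition condC1 h := forall n, (1 <= n)%N ->
  finite_set [set k | (1 <= k)%N /\ h n k != 0].

(* Under C1 and h n 1 = 1 the supremum is a maximum. *)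
Definition condC2 h (rho1 : R) := forall n, (1 <= n)%N ->
  rho1 * ln n%:R ^+ 2 * sup [set freq R k * h n k | k in [set k | (1 <= k)%N]]
  <= Num.sqrt (sum1 (fun k => freq R k ^+ 2 * h n k ^+ 2)).

Definition condC3 h (D1 : R) := forall n, (1 <= n)%N ->
  sum1 (fun k => h n k * freq R k ^+ 4) <= D1 * n%:R.

Definition condT h (F : set (R -> R)) := forall e : R, 0 < e ->
  exists N : nat, forall n, (N <= n)%N -> forall f, F f ->
    (sum1 (fun k => (1 - h n k) * freq R k ^+ 2 * fcoef f k ^+ 2)) ^+ 2
    <= e * sum1 (fun k => (1 - h n k) ^+ 2 * freq R k ^+ 2 * fcoef f k ^+ 2).

End weights.

Definition argmax (R : realType) (A : set R) (g : R -> R) : set R :=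
  [set x | A x /\ forall y, A y -> g y <= g x].

Section model.
Context (R : realType) (d : measure_display) (Om : measurableType d).
Context (P : probability Om R).

Definition has_law (X : {RV P >-> R}) (nu : set R -> \bar R) :=
  forall B : set R, measurable B -> distribution P X B = nu B.

(* Taking some of the B i equal to setT gives the product rule for every
   subfamily. *)
Definition mutually_independent (I : finType) (X : I -> {RV P >-> R}) :=
  forall B : I -> set R, (forall i, measurable (B i)) ->
    P (\bigcap_(i in [set: I]) (X i @^-1` B i)) =
    \big[*%E/1%E]_(i : I) P (X i @^-1` B i).

Definition joint_family (n J : nat) (theta : 'I_J -> {RV P >-> R})
    (eps : 'I_n -> 'I_J -> {RV P >-> R}) (s : 'I_J + 'I_n * 'I_J) :
    {RV P >-> R} :=
  match s with inl j => theta j | inr ij => eps ij.1 ij.2 end.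

Definition shift_noise_model (mu : probability (measurableTypeR R) R)
    (n J : nat) (theta : 'I_J -> {RV P >-> R})
    (eps : 'I_n -> 'I_J -> {RV P >-> R}) :=
  [/\ forall j, has_law (theta j) mu,
      forall i j, has_law (eps i j) (normal_prob 0 1)
    & mutually_independent (joint_family theta eps)].

(* Ordinals start at 0: i : 'I_n encodes the design point t_(i+1) = (i+1)/n. *)
Definition design (n : nat) (i : 'I_n) : R := i.+1%:R / n%:R.

Definition observations (n J : nat) (f : 'I_J -> R -> R)
    (theta : 'I_J -> Om -> R) (eps : 'I_n -> 'I_J -> Om -> R) (w : Om) :
    'M[R]_(n, J) :=
  \matrix_(i, j) (f j (design i - theta j w) + eps i j w).

Definition criterion (n J : nat) (h : nat -> R) (y : 'M[R]_(n, J)) (j : 'I_J)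
    (tau : R) : R :=
  sum1 (fun k => h k *
    (n%:R^-1 * \sum_(i < n) cos (freq R k * (design i - tau)) * y i j) ^+ 2).

Definition deviation_event (n J : nat) (f : 'I_J -> R -> R)
    (eps : 'I_n -> 'I_J -> Om -> R) (est : 'M[R]_(n, J) -> R) (j : 'I_J)
    (x : R) (theta : 'I_J -> Om -> R) : set Om :=
  [set w | x < Num.sqrt n%:R *
               `|est (observations f theta eps w) - theta j w|].

Definition fix_shift (J : nat) (theta : 'I_J -> Om -> R) (j : 'I_J) (t : R) :
    'I_J -> Om -> R :=
  fun l => if l == j then cst t else theta l.

(* Conditional probability given theta_j = t of an event E depending on the
   shifts: the probability when the shift of curve j is fixed at t. Since
   theta_j is independent of the other shifts and of the noise, this is, as a
   function of t, the version of P(E theta | theta_j = t) that is defined at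
   every t and not only mu-almost everywhere. *)
Definition cond_prob_shift (J : nat) (theta : 'I_J -> Om -> R) (j : 'I_J)
    (t : R) (E : ('I_J -> Om -> R) -> set Om) : \bar R :=
  P (E (fix_shift theta j t)).

End model.

Definition xn (R : realType) (K : R) (n : nat) : R := K * Num.sqrt (ln n%:R).

(* Main.v *)
Require Import Defs.
From HB Require Import structures.
From mathcomp Require Import all_boot all_order all_algebra.
From mathcomp Require Import all_classical all_reals all_analysis.
From mathcomp Require Import measurable_realfun finmap.
From mathcomp Require Import ring lra zify.

(** The criterion is the sum of h_k A_k(tau)^2, where A_k(tau) is the empirical
    cosine coefficient of order k of the observations shifted by tau. Writing
    g_k = f_k / sqrt 2 and w_k = 2 pi k,
      A_k(tau) = g_k cos(w_k (tau - theta)) + E_k(tau),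
    where the error E_k is trigonometric in tau with coefficients bounded by
    some r_k that does not depend on tau.

    Without the errors, passing from theta to tau costs at least
    g_1^2 sin^2(2 pi (tau - theta)), because h_1 = 1; since the shifts are less
    than a quarter of the period, this is at least a constant times
    (tau - theta)^2 ([sin_coercive]). The errors change the increment of the
    criterion by at most |tau - theta| times the sum of h_k w_k (|g_k| r_k + r_k^2),
    up to a constant. The maximizer of the criterion gains at least 0, so one
    factor |tau - theta| cancels and the error of the estimator is at most a
    constant times that sum ([shift_error_le]). This inequality is deterministic:
    no supremum over tau is left.

    The bound r_k has two parts. The aliasing error, made by replacing integrals
    with averages over the design, is O(k / n) ([design_cos_avg]): products of
    cosines of frequencies k and l average exactly as their integral when
    k + l < n, and the other frequencies carry little mass because the sum of
    l |f_l| is finite, by the Bessel inequality for f''. The noise part is z_k / sqrt n with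
    z_k sub-Gaussian, uniformly in k ([noise_subgaussian]).

    After multiplication by sqrt n and with s = n^(1/10), three terms remain
    ([scaled_error_le]): a bias O(1 / s), below x_n for n large; the sum of
    h_k k |f_k| z_k, whose weights have bounded total mass; and s^-5 times the sum
    of h_k k z_k^2, whose weights have mass O(s^4) by [condC3]. Convexity reduces each
    random sum to a single variable ([weighted_sum_tail]). The linear sum gets a
    tail exp(- c x^2) with c free of K ([linear_tail]). The quadratic sum exceeds
    its threshold with probability O(s^-p) for every p ([quadratic_tail]), and
    as exp(- c x_n^2) is a power of s with an exponent proportional to K^2, taking
    p large enough depending on K makes this contribution smaller
    ([moment_tail_le_gaussian]). *)

Set Implicit Arguments.
Unset Strict Implicit.
Unset Printing Implicit Defensive.

Import Order.TTheory GRing.Theory Num.Theory.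
Import numFieldTopology.Exports numFieldNormedType.Exports.

Local Open Scope classical_set_scope.
Local Open Scope ring_scope.

(** * Integration against densities and independence *)

Section density.
Import HBNNSimple.

(** A change of variables through an image measure with a density. Both sides
are monotone limits of their values at simple functions, so it suffices to
know them on indicators. It serves twice: with [mu = P] and [nu] a multiple of
a law, and with [mu] the Lebesgue measure and [nu] the normal law. *)
Lemma integral_density (R : realType) (d d' : measure_display)
    (T : measurableType d) (T' : measurableType d')
    (mu : {measure set T -> \bar R}) (nu : {measure set T' -> \bar R})
    (X : T -> T') (G : T -> R) :
  measurable_fun setT X -> measurable_fun setT G -> (forall w, 0 <= G w) ->
  (forall B, measurable B -> (\int[mu]_w (\1_B (X w) * G w)%:E = nu B)%E) ->
  forall g : T' -> R, measurable_fun setT g -> (forall x, 0 <= g x) ->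
  (\int[mu]_w (g (X w) * G w)%:E = \int[nu]_x (g x)%:E)%E.
Proof.
move=> mX mG G0 HB g mg g0.
have simple (s : {nnsfun T' >-> R}) :
    (\int[mu]_w (s (X w) * G w)%:E = \int[nu]_x (s x)%:E)%E.
  have ms (y : R) : measurable (s @^-1` [set y]) by exact: measurable_funPTI.
  have mind (y : R) : measurable_fun setT (fun w => \1_(s @^-1` [set y]) (X w) : R).
    by apply: (measurableT_comp (f := \1_(s @^-1` [set y]) : T' -> R)) => //.
  have sE x : s x = \sum_(y <- fset_set (range s)) y * \1_(s @^-1` [set y]) x.
    by rewrite [LHS]fimfunE fsbig_finite.
  have nneg y x : 0 <= y * \1_(s @^-1` [set y]) x by exact: nnfun_muleindic_ge0.
  under eq_integral do rewrite sE mulr_suml -sumEFin.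
  under [RHS]eq_integral do rewrite sE -sumEFin.
  rewrite !ge0_integral_sum//; first last.
  - by move=> y x _; rewrite lee_fin mulr_ge0.
  - by move=> y; apply/measurable_EFinP; do 2 apply: measurable_funM => //.
  - by move=> y x _; rewrite lee_fin.
  - by move=> y; apply/measurable_EFinP; apply: measurable_funM => //.
  apply: eq_big_seq => y; rewrite in_fset_set// => /set_mem[x _ xy].
  have y0 : 0 <= y by rewrite -xy.
  under [RHS]eq_integral do rewrite EFinM.
  under eq_integral do rewrite -mulrA EFinM.
  rewrite !ge0_integralZl//.
  - by rewrite HB// integral_indic// setIT.
  - by apply/measurable_EFinP.
  - by apply/measurable_EFinP; apply: measurable_funM.
  - by move=> w _; rewrite lee_fin mulr_ge0.
have mge : measurable_fun setT (EFin \o g) by apply/measurable_EFinP.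
pose s_ := nnsfun_approx measurableT mge.
have cvgs x : (s_ n x)%:E @[n --> \oo] --> (g x)%:E.
  by apply: cvg_nnsfun_approx => // y _; rewrite lee_fin.
have nds m n : (m <= n)%N -> forall x, s_ m x <= s_ n x.
  by move=> mn x; have /lefP := nd_nnsfun_approx measurableT mge mn; exact.
have c1 : (\int[mu]_w (s_ n (X w) * G w)%:E @[n --> \oo] --> \int[mu]_w (g (X w) * G w)%:E)%E.
  have -> : (\int[mu]_w (g (X w) * G w)%:E = \int[mu]_w (limn (fun n => (s_ n (X w) * G w)%:E)))%E.
    apply: eq_integral => w _; apply/esym/cvg_lim => //.
    rewrite EFinM; under eq_fun do rewrite EFinM.
    exact: cvgeZr.
  apply: cvg_monotone_convergence => //.
  - by move=> n; apply/measurable_EFinP; apply: measurable_funM => //; apply: measurableT_comp.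
  - by move=> n w _; rewrite lee_fin mulr_ge0.
  - by move=> w _ m n mn; rewrite lee_fin ler_wpM2r// nds.
have c2 : (\int[nu]_x (s_ n x)%:E @[n --> \oo] --> \int[nu]_x (g x)%:E)%E.
  have -> : (\int[nu]_x (g x)%:E = \int[nu]_x (limn (fun n => (s_ n x)%:E)))%E.
    by apply: eq_integral => w _; apply/esym/cvg_lim.
  apply: cvg_monotone_convergence => //.
  - by move=> n; apply/measurable_EFinP.
  - by move=> n w _; rewrite lee_fin.
  - by move=> w _ m n mn; rewrite lee_fin nds.
apply: (cvg_unique _ c1) => //.
rewrite (_ : (fun _ => _) = (fun n => \int[nu]_x (s_ n x)%:E)%E)//.
by apply/funext => n; exact: simple.
Qed.

End density.

Section independence.
Context (R : realType) (d : measure_display) (Om : measurableType d)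
  (P : probability Om R).

(** One step of the product rule for expectations: factorization over the events
[X \in B] passes to all nonnegative functions of [X]. *)
Lemma integral_comp_factor (X : {RV P >-> R}) (G : Om -> R) (c : R) :
  measurable_fun setT G -> (forall w, 0 <= G w) -> 0 <= c ->
  (forall B, measurable B ->
     (\int[P]_w (\1_B (X w) * G w)%:E = P (X @^-1` B) * c%:E)%E) ->
  forall g : R -> R, measurable_fun setT g -> (forall x, 0 <= g x) ->
  (\int[P]_w (g (X w) * G w)%:E = \int[P]_w (g (X w))%:E * c%:E)%E.
Proof.
move=> mG G0 c0 HB g mg g0.
rewrite (@integral_density _ _ _ _ _ P (mscale (NngNum c0) (distribution P X)) X)//.
  rewrite ge0_integral_mscale//; last 2 first.
    exact/measurable_EFinP.
    by move=> x _; exact: g0.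
  rewrite muleC ge0_integral_distribution//; first exact/measurable_EFinP.
by move=> B mB; rewrite HB//= /mscale/= muleC.
Qed.

(** Completing the square, exp(a x) times the standard normal density is
exp(a^2 / 2) times the normal density of mean a. *)
Lemma gaussian_mgf (X : {RV P >-> R}) (a : R) :
  has_law X (normal_prob 0 1) ->
  (\int[P]_w (expR (a * X w))%:E = (expR (a ^+ 2 / 2))%:E)%E.
Proof.
move=> lawX.
have mexp : measurable_fun [set: R] (fun x => expR (a * x)).
  by apply: measurableT_comp => //; exact: measurable_funM.
have one0 : 1 != 0 :> R by [].
transitivity (\int[distribution P X]_x (expR (a * x))%:E)%E.
  rewrite ge0_integral_distribution//; first exact/measurable_EFinP.
transitivity (\int[lebesgue_measure]_x (expR (a * x) * normal_pdf 0 1 x)%:E)%E.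
  have dens : forall B : set R, measurable B ->
      (\int[lebesgue_measure]_x (\1_B (idfun x) * normal_pdf 0 1 x)%:E =
       distribution P X B)%E.
    move=> B mB; rewrite lawX// /normal_prob [RHS]integral_mkcond.
    apply: eq_integral => x _; rewrite patchE indicE /=.
    by case: ifP => _; rewrite ?mul1r ?mul0r.
  have mid : @measurable_fun _ _ (measurableTypeR R) R setT idfun.
    by move=> _ B mB; rewrite setTI preimage_id; exact: mB.
  have := integral_density mid (measurable_normal_pdf 0 1)
    (normal_pdf_ge0 0 1) dens mexp (fun x => expR_ge0 _).
  by [].
transitivity (\int[lebesgue_measure]_x
    ((expR (a ^+ 2 / 2))%:E * (normal_pdf a 1 x)%:E))%E.
  apply: eq_integral => x _; rewrite -EFinM; congr EFin.
  rewrite !normal_pdfE// mulrCA [in RHS]mulrCA /normal_fun -!expRD.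
  by congr (_ * expR _); field.
rewrite ge0_integralZl//.
- by rewrite integral_normal_pdf mule1.
- apply/measurable_EFinP; exact: measurable_normal_pdf.
- by move=> x _; rewrite lee_fin normal_pdf_ge0.
Qed.

Lemma integral_indic_RV (X : {RV P >-> R}) (B : set R) : measurable B ->
  (\int[P]_w (\1_B (X w))%:E = P (X @^-1` B))%E.
Proof.
move=> mB; transitivity (\int[P]_w (\1_(X @^-1` B) w)%:E)%E.
  by apply: eq_integral => w _; rewrite !indicE.
by rewrite integral_indic ?setIT//; exact: measurable_funPTI.
Qed.

(** Independence is given for events, that is, for indicators. They are replaced
by arbitrary nonnegative functions one index after the other: [s] lists the
indices at which the replacement has been made. *)
Lemma integral_prod_indep (I : finType) (X : I -> {RV P >-> R})
    (g : I -> R -> R) (m : I -> R) :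
  mutually_independent X ->
  (forall i, measurable_fun setT (g i)) -> (forall i x, 0 <= g i x) ->
  (forall i, \int[P]_w (g i (X i w))%:E = (m i)%:E)%E ->
  (\int[P]_w (\prod_i g i (X i w))%:E = (\prod_i m i)%:E)%E.
Proof.
move=> indX.
suff main (s : seq I) : forall (g : I -> R -> R) (m : I -> R),
    (forall i, i \notin s -> exists2 B, measurable B & g i = \1_B) ->
    (forall i, measurable_fun setT (g i)) -> (forall i x, 0 <= g i x) ->
    (forall i, \int[P]_w (g i (X i w))%:E = (m i)%:E)%E ->
    (\int[P]_w (\prod_i g i (X i w))%:E = (\prod_i m i)%:E)%E.
  move=> mg g0 gm; apply: (main (enum I)) => // i.
  by rewrite mem_enum.
elim: s => [|i0 s IH] {}g {}m gB mg g0 gm.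
  have {}gB i : exists B, measurable B /\ g i = \1_B.
    by have [//|B] := gB i; exists B.
  have [B /all_and2 [mB gBE]] := choice gB.
  have PB i : P (X i @^-1` B i) = (m i)%:E.
    by rewrite -gm gBE integral_indic_RV.
  have mI : measurable (\bigcap_(i in [set: I]) (X i @^-1` B i)).
    by apply: fin_bigcap_measurable => // i _; exact: measurable_funPTI.
  transitivity (\int[P]_w (\1_(\bigcap_(i in [set: I]) (X i @^-1` B i)) w)%:E)%E.
    apply: eq_integral => w _; congr EFin; rewrite indicE.
    case: (boolP (w \in _)) => [/set_mem wB|].
      rewrite big1// => i _; rewrite gBE indicE mem_set//.
      exact: (wB i Logic.I).
    move/negP => wB; apply/eqP/prodf_eq0.
    have [i Bi] : exists i, ~ B i (X i w).
      apply: contrapT => /forallNP H; apply: wB; apply/mem_set => i _ /=.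
      exact: contrapT (H i).
    by exists i => //; rewrite gBE indicE memNset.
  rewrite integral_indic// setIT; apply: (etrans (indX B mB)).
  rewrite (eq_bigr (fun i => (m i)%:E)); last by move=> i _; exact: PB.
  by rewrite (big_morph EFin EFinM erefl).
have m_ge0 i : 0 <= m i.
  by rewrite -lee_fin -gm; apply: integral_ge0 => w _; rewrite lee_fin.
pose G w := \prod_(i | i != i0) g i (X i w).
pose c := \prod_(i | i != i0) m i.
transitivity (\int[P]_w (g i0 (X i0 w) * G w)%:E)%E.
  by apply: eq_integral => w _; rewrite (bigD1 i0).
rewrite [in RHS](bigD1 i0)//= EFinM -gm.
apply: integral_comp_factor => //.
- rewrite /G; under eq_fun do rewrite -big_filter.
  by apply: measurable_prod => i _; exact: measurableT_comp.
- by move=> w; apply: prodr_ge0.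
- by apply: prodr_ge0.
move=> B mB.
have fB : P (X i0 @^-1` B) \is a fin_num.
  by apply: fin_num_measure; exact: measurable_funPTI.
pose g' i := if i == i0 then \1_B else g i.
pose m' i := if i == i0 then fine (P (X i0 @^-1` B)) else m i.
have := IH g' m'; rewrite (bigD1 i0)//= /m' eqxx EFinM fineK//.
rewrite (eq_bigr m); last by move=> i /negbTE ->.
rewrite -/c => <-.
- apply: eq_integral => w _; rewrite (bigD1 i0)//= /g' eqxx.
  by congr (_ * _)%:E; apply: eq_bigr => i /negbTE ->.
- move=> i si; rewrite /g'; case: eqP => [_|ii0]; first by exists B.
  by apply: gB; rewrite in_cons negb_or si andbT; apply/eqP.
- by move=> i; rewrite /g'; case: eqP => // _; exact: measurable_indic.
- by move=> i x; rewrite /g'; case: eqP => // _; rewrite indicE.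
- move=> i; rewrite /g'; case: eqP => [->|_]; last exact: gm.
  by rewrite fineK// integral_indic_RV.
Qed.

Lemma measurable_gt_set (F : Om -> R) (x : R) :
  measurable_fun setT F -> measurable [set w | x < F w].
Proof.
move=> mF; rewrite (_ : [set w | _] = setT `&` F @^-1` `]x, +oo[%classic).
  exact: mF.
by rewrite setTI; apply/seteqP; split => w /=; rewrite in_itv/= andbT.
Qed.

Lemma integral_cst_probability (x : R) : (\int[P]_w x%:E = x%:E)%E.
Proof.
rewrite integral_cst//; apply: (etrans _ (mule1 _)); congr (_ * _)%E.
exact: probability_setT.
Qed.

Lemma gaussian_sum_mgf (I : finType) (X : I -> {RV P >-> R}) (a : I -> R) :
  mutually_independent X ->
  (forall i, a i != 0 -> has_law (X i) (normal_prob 0 1)) ->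
  (\int[P]_w (expR (\sum_i a i * X i w))%:E = (expR ((\sum_i a i ^+ 2) / 2))%:E)%E.
Proof.
move=> indX lawX.
under eq_integral do rewrite expR_sum.
rewrite mulr_suml expR_sum.
apply: (@integral_prod_indep _ X (fun i x => expR (a i * x))) => //.
- by move=> i; apply: measurableT_comp => //; exact: measurable_funM.
- move=> i; have [a0|a0] := eqVneq (a i) 0; last exact/gaussian_mgf/lawX.
  rewrite a0; under eq_integral do rewrite mul0r expR0.
  by rewrite integral_cst_probability expr0n mul0r expR0.
Qed.

Lemma probability_le_integral (A : set Om) (g : Om -> R) (b c : R) :
  measurable A -> measurable_fun setT g -> (forall w, 0 <= g w) -> 0 < c ->
  (forall w, A w -> c <= g w) -> (\int[P]_w (g w)%:E <= b%:E)%E ->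
  (P A <= (b / c)%:E)%E.
Proof.
move=> mA mg g0 c0 cg gb.
rewrite EFinM lee_pdivlMr// muleC -integral_cst//.
apply: le_trans gb; apply: (@le_trans _ _ (\int[P]_(w in A) (g w)%:E)%E).
  apply: ge0_le_integral => //.
  - by move=> w _; rewrite lee_fin ltW.
  - by apply/measurable_EFinP; exact: measurable_funTS.
apply: ge0_subset_integral => //.
  exact/measurable_EFinP.
by move=> w _; rewrite lee_fin.
Qed.

(** Jensen and Markov in one step. If the weighted sum exceeds [C * m], the
tangent line of [phi] at [m] shows that the weighted sum of the [phi (Z k)]
exceeds [C * phi m], after the missing mass [C - \sum v k] has been put at 0.
Only one-dimensional bounds on the [phi (Z k)] enter. *)
Lemma weighted_sum_tail (M : nat) (v : nat -> R) (Z : nat -> Om -> R)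
    (phi : R -> R) (C m B slope : R) :
  0 < C -> (forall k, (1 <= k)%N -> 0 <= v k) -> \sum_(1 <= k < M) v k <= C ->
  (forall k, measurable_fun setT (Z k)) -> (forall k w, 0 <= Z k w) ->
  measurable_fun setT phi -> (forall x, 0 <= x -> 0 <= phi x) ->
  phi 0 <= B -> (forall k, (\int[P]_w (phi (Z k w))%:E <= B%:E)%E) ->
  0 <= slope -> (forall y, 0 <= y -> phi m + slope * (y - m) <= phi y) ->
  0 < phi m ->
  (P [set w | C * m < \sum_(1 <= k < M) v k * Z k w]%R <= (B / phi m)%:E)%E.
Proof.
move=> C0 v0 vC mZ Z0 mphi phi0 phi0B intB s0 tangent phim0.
set V := \sum_(1 <= k < M) v k.
have V0 : 0 <= V by rewrite /V big_nat; apply: sumr_ge0 => k /andP[? _]; exact: v0.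
pose g w := \sum_(1 <= k < M) v k * phi (Z k w) + (C - V) * phi 0.
have mpZ k : measurable_fun setT (fun w => phi (Z k w)) by exact: measurableT_comp.
have Bm0 : 0 <= B by apply: le_trans phi0B; exact: phi0.
have vphi0 k w : (1 <= k)%N -> 0 <= v k * phi (Z k w).
  by move=> k1; rewrite mulr_ge0 ?v0 ?phi0.
have -> : B / phi m = C * B / (C * phi m).
  by rewrite invfM mulrACA divff ?mul1r// gt_eqF.
have sum0 w : 0 <= \sum_(1 <= k < M) v k * phi (Z k w).
  by rewrite big_nat; apply: sumr_ge0 => k /andP[? _]; exact: vphi0.
have msum (F : nat -> Om -> R) : (forall k, measurable_fun setT (F k)) ->
    measurable_fun setT (fun w => \sum_(1 <= k < M) v k * F k w).
  by move=> mF; apply: measurable_sum => k; exact: measurable_funM.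
apply: (@probability_le_integral _ g).
- exact/measurable_gt_set/msum.
- by apply: measurable_funD => //; exact: msum.
- by move=> w; rewrite addr_ge0// mulr_ge0 ?phi0// subr_ge0.
- by rewrite mulr_gt0.
- move=> w /= Cm.
  have step : \sum_(1 <= k < M) v k * (phi m + slope * (Z k w - m)) <=
      \sum_(1 <= k < M) v k * phi (Z k w).
    rewrite !big_nat; apply: ler_sum => k /andP[k1 _].
    by rewrite ler_wpM2l ?v0// tangent.
  have t0 : phi m + slope * (0 - m) <= phi 0 by exact: tangent.
  rewrite /g; apply: le_trans (lerD step (ler_wpM2l _ t0)); last by rewrite subr_ge0.
  rewrite (_ : \sum_(_ <= _ < _) _ =
      V * (phi m - slope * m) + slope * \sum_(1 <= k < M) v k * Z k w); last first.
    by rewrite /V mulr_suml mulr_sumr -big_split/=; apply: eq_bigr => k _; ring.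
  rewrite -subr_ge0; set S := \sum_(_ <= _ < _) _ in Cm *.
  rewrite (_ : _ - _ = slope * (S - C * m)); last by ring.
  by rewrite mulr_ge0// subr_ge0 ltW.
- rewrite (_ : (fun w => _) = (fun w => (\sum_(0 <= k < M.-1) (v k.+1 * phi (Z k.+1 w))%:E
      + ((C - V) * phi 0)%:E)%E)); last first.
    by apply/funext => w; rewrite /g EFinD -sumEFin big_add1.
  have mk k : measurable_fun setT (fun w => (v k.+1 * phi (Z k.+1 w))%:E).
    by apply/measurable_EFinP; exact: measurable_funM.
  have nk k w : (0 <= (v k.+1 * phi (Z k.+1 w))%:E)%E by rewrite lee_fin vphi0.
  rewrite ge0_integralD//; last 3 first.
  + by move=> w _; apply: sume_ge0 => k _; exact: nk.
  + exact: emeasurable_sum.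
  + by move=> w _; rewrite lee_fin mulr_ge0 ?phi0// subr_ge0.
  rewrite integral_cst_probability ge0_integral_sum//.
  rewrite (_ : C * B = (\sum_(0 <= k < M.-1) v k.+1 * B) + (C - V) * B); last first.
    by rewrite -mulr_suml -(big_add1 _ _ _ _ predT) -/V; ring.
  rewrite EFinD -sumEFin leeD//.
    apply: lee_sum => k _; under eq_integral do rewrite EFinM.
    rewrite ge0_integralZl//; last 3 first.
    * by apply/measurable_EFinP.
    * by move=> w _; rewrite lee_fin phi0.
    * by rewrite lee_fin v0.
    by rewrite EFinM lee_wpmul2l// lee_fin v0.
  by rewrite lee_fin ler_wpM2l// subr_ge0.
Qed.
End independence.

(** * Sub-Gaussian tails of weighted sums *)

Lemma expr_le_fact_expR (R : realType) (x : R) q : 0 <= x -> x ^+ q <= q`!%:R * expR x.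
Proof.
move=> x0; case: q => [|q].
  by rewrite expr0 fact0 mul1r -[leLHS]expR0 ler_expR.
rewrite mulrC -ler_pdivrMr ?ltr0n ?fact_gt0//.
by apply: le_trans (expR_ge1Dxn q x0); rewrite lerDr.
Qed.

Section subgaussian.
Context (R : realType) (d : measure_display) (Om : measurableType d)
  (P : probability Om R).

Definition subgaussian (Z : Om -> R) :=
  measurable_fun setT Z /\
  forall s : R, (\int[P]_w (expR (s * Z w))%:E <= (expR (s ^+ 2 / 2))%:E)%E.

(** The independence hypothesis concerns the shifts and all the noise variables
jointly; the linear form in the noise of one curve is a linear form in that
whole family, with coefficient 0 at the other indices. *)
Lemma noise_subgaussian (mu : probability (measurableTypeR R) R) (n J : nat)
    (theta : 'I_J -> {RV P >-> R}) (eps : 'I_n -> 'I_J -> {RV P >-> R})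
    (j : 'I_J) (b : 'I_n -> R) :
  shift_noise_model mu theta eps -> \sum_i b i ^+ 2 <= 1 ->
  subgaussian (fun w => \sum_i b i * eps i j w).
Proof.
move=> [_ law_eps indep] b1; split.
  by apply: measurable_sum => i; exact: measurable_funM.
move=> s.
pose a (i : 'I_J + 'I_n * 'I_J) : R :=
  if i is inr il then (if il.2 == j then s * b il.1 else 0) else 0.
have sumE (T : nmodType) (F : 'I_J + 'I_n * 'I_J -> T) :
    (forall i, a i = 0 -> F i = 0) -> \sum_i F i = \sum_i F (inr (i, j)).
  move=> F0; rewrite big_sumType/= big1 ?add0r; last by move=> i _; rewrite F0.
  rewrite (eq_bigr (fun p => F (inr (p.1, p.2)))); last by case.
  rewrite -(pair_bigA _ (fun i l => F (inr (i, l))))/=.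
  apply: eq_bigr => i _; rewrite (bigD1 j)//= big1 ?addr0// => l lj.
  by rewrite F0//= (negbTE lj).
have sE w : s * (\sum_i b i * eps i j w) = \sum_i a i * joint_family theta eps i w.
  rewrite sumE; last by move=> i ->; rewrite mul0r.
  by rewrite mulr_sumr; apply: eq_bigr => i _; rewrite /= eqxx mulrA.
have aE : \sum_i a i ^+ 2 = s ^+ 2 * \sum_i b i ^+ 2.
  rewrite sumE; last by move=> i ->; rewrite expr0n.
  by rewrite mulr_sumr; apply: eq_bigr => i _; rewrite /= eqxx exprMn.
under eq_integral do rewrite sE.
rewrite gaussian_sum_mgf//; last by move=> [l|[i l]] /=; rewrite ?eqxx.
by rewrite lee_fin ler_expR ler_pM2r// aE ler_piMr// sqr_ge0.
Qed.

(** By the inequality between arithmetic and geometric means, the exponential of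
s (|x| + |y|) is at most half the sum of the four exponentials of 2 s x, - 2 s x,
2 s y and - 2 s y. *)
Lemma abs_pair_mgf (Z Z' : Om -> R) (s : R) :
  subgaussian Z -> subgaussian Z' -> 0 <= s ->
  (\int[P]_w (expR (s * (`|Z w| + `|Z' w|)))%:E <= (2 * expR (2 * s ^+ 2))%:E)%E.
Proof.
move=> [mZ sgZ] [mZ' sgZ'] s0.
pose e (t : R) (X : Om -> R) w : \bar R := (expR (t * X w))%:E.
have me t X : measurable_fun setT X -> measurable_fun setT (e t X).
  move=> mX; apply/measurable_EFinP; apply: measurableT_comp => //.
  exact: measurable_funM.
have e0 t X w : (0 <= e t X w)%E by rewrite lee_fin expR_ge0.
have eB t X : subgaussian X -> t ^+ 2 = (2 * s) ^+ 2 ->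
    (\int[P]_w e t X w <= (expR (2 * s ^+ 2))%:E)%E.
  move=> [_ sgX] tE; apply: (le_trans (sgX t)).
  by rewrite tE lee_fin ler_expR; lra.
pose h w : \bar R := (e (2 * s)%R Z w + e (- (2 * s))%R Z w +
  (e (2 * s)%R Z' w + e (- (2 * s))%R Z' w))%E.
have mh : measurable_fun setT h.
  by do 2 apply: emeasurable_funD; exact: me.
have h0 w : (0 <= h w)%E by rewrite !adde_ge0.
pose g w : \bar R := ((2^-1)%:E * h w)%E.
have expabs (x : R) : expR (2 * s * `|x|) <= expR (2 * s * x) + expR (- (2 * s) * x).
  have [x0|x0] := leP 0 x; first by rewrite ger0_norm// lerDl expR_ge0.
  by rewrite ltr0_norm// mulrN mulNr lerDr expR_ge0.
apply: (@le_trans _ _ (\int[P]_w g w)%E).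
  apply: ge0_le_integral => //.
  - apply/measurable_EFinP; apply: measurableT_comp => //.
    apply: measurable_funM => //; apply: measurable_funD; exact: measurableT_comp.
  - exact: emeasurable_funM.
  - move=> w _; rewrite /g /h -!EFinD -EFinM lee_fin.
    have := expabs (Z w); have := expabs (Z' w).
    set x := expR (2 * s * `|Z w|); set y := expR (2 * s * `|Z' w|).
    suff : expR (s * (`|Z w| + `|Z' w|)) <= (x + y) / 2 by lra.
    have -> : x = expR (s * `|Z w|) ^+ 2 by rewrite -expRM_natl mulrA.
    have -> : y = expR (s * `|Z' w|) ^+ 2 by rewrite -expRM_natl mulrA.
    rewrite mulrDr expRD; set a := expR (s * `|Z w|); set b := expR _.
    rewrite -subr_ge0 (_ : _ - _ = (a - b) ^+ 2 / 2); last by field.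
    by rewrite divr_ge0// sqr_ge0.
rewrite /g ge0_integralZl//.
pose E : \bar R := (expR (2 * s ^+ 2))%:E.
have intZ X : subgaussian X ->
    (\int[P]_w (e (2 * s)%R X w + e (- (2 * s))%R X w) <= E + E)%E.
  move=> sgX; rewrite ge0_integralD//; [|exact: me sgX.1..].
  by apply: leeD; apply: eB => //; rewrite sqrrN.
apply: (@le_trans _ _ ((2^-1)%:E * (E + E + (E + E)))%E).
  have mP X : measurable_fun setT X ->
      measurable_fun setT (fun w => e (2 * s)%R X w + e (- (2 * s))%R X w)%E.
    by move=> mX; apply: emeasurable_funD; exact: me.
  have nP X w : setT w -> (0 <= e (2 * s)%R X w + e (- (2 * s))%R X w)%E.
    by move=> _; rewrite adde_ge0.
  apply: lee_wpmul2l => //; rewrite /h.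
  rewrite (ge0_integralD P measurableT (nP Z) (mP _ mZ) (nP Z') (mP _ mZ')).
  by apply: leeD; exact: intZ.
by rewrite /E -!EFinD -EFinM lee_fin; lra.
Qed.

Context (M : nat) (v : nat -> R) (Z Z' : nat -> Om -> R) (C m : R)
  (C0 : 0 < C) (v0 : forall k, (1 <= k)%N -> 0 <= v k)
  (vC : \sum_(1 <= k < M) v k <= C) (m0 : 0 < m)
  (sgZ : forall k, subgaussian (Z k)) (sgZ' : forall k, subgaussian (Z' k)).

(** The slope [m / 4] of the exponent minimizes 2 a^2 - a m. The bound depends on
the weights through their total mass only. *)
Lemma linear_tail :
  (P [set w | C * m < \sum_(1 <= k < M) v k * (`|Z k w| + `|Z' k w|)]%R <=
   (2 * expR (- (m ^+ 2 / 8)))%:E)%E.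
Proof.
have -> : 2 * expR (- (m ^+ 2 / 8)) =
    2 * expR (2 * (m / 4) ^+ 2) / expR (m / 4 * m).
  by rewrite -mulrA -expRB; congr (_ * expR _); field.
apply: (@weighted_sum_tail _ _ _ _ M v (fun k w => `|Z k w| + `|Z' k w|)
  (fun x => expR (m / 4 * x)) _ _ _ (m / 4 * expR (m / 4 * m))) => //.
- move=> k; apply: measurable_funD; apply: measurableT_comp => //;
    [exact: (sgZ k).1|exact: (sgZ' k).1].
- by apply: measurableT_comp => //; exact: measurable_funM.
- rewrite mulr0 expR0 -[leLHS]mulr1 ler_pM// ?ler1n//.
  by rewrite -[leLHS]expR0 ler_expR mulr_ge0 ?sqr_ge0.
- by move=> k; apply: abs_pair_mgf (sgZ k) (sgZ' k) _; rewrite divr_ge0// ltW.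
- by rewrite mulr_ge0 ?expR_ge0// divr_ge0// ltW.
- move=> y y0; set c := m / 4.
  have -> : expR (c * y) = expR (c * m) * expR (c * (y - m)).
    by rewrite -expRD; congr expR; ring.
  have := expR_ge1Dx (c * (y - m)); have := expR_gt0 (c * m).
  by nra.
- exact: expR_gt0.
Qed.

(** For sums of squares a moment of large order is enough, because the
threshold will be larger than the total mass of the weights by a power of the
sample size. *)
Lemma quadratic_tail (p : nat) :
  (P [set w | C * m < \sum_(1 <= k < M) v k * (`|Z k w| + `|Z' k w|) ^+ 2]%R <=
   ((2 * p)`!%:R * (2 * expR 2) / m ^+ p)%:E)%E.
Proof.
(* the Bernoulli inequality, as the tangent line of the power function *)
have tangent q y : 0 <= y -> m ^+ q + q%:R * m ^+ q.-1 * (y - m) <= y ^+ q.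
  move=> y0; elim: q => [|q IH]; first by rewrite !expr0 mul0r mul0r addr0.
  have : y * (m ^+ q + q%:R * m ^+ q.-1 * (y - m)) <= y * y ^+ q.
    by rewrite ler_wpM2l.
  rewrite -exprS; apply: le_trans.
  case: q {IH} => [|q] /=; first by rewrite !expr0 expr1; lra.
  rewrite -subr_ge0 (_ : _ - _ = q.+1%:R * m ^+ q * (y - m) ^+ 2).
    by rewrite mulr_ge0 ?sqr_ge0// mulr_ge0// exprn_ge0// ltW.
  by rewrite -[in q.+2%:R]natr1 !exprS; ring.
apply: (@weighted_sum_tail _ _ _ _ M v (fun k w => (`|Z k w| + `|Z' k w|) ^+ 2)
  (fun x => x ^+ p) _ _ _ (p%:R * m ^+ p.-1)) => //.
- move=> k; apply: measurable_funX; apply: measurable_funD;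
  apply: measurableT_comp => //; [exact: (sgZ k).1|exact: (sgZ' k).1].
- by move=> x x0; rewrite exprn_ge0.
- rewrite expr0n; apply: (@le_trans _ _ 1); first by case: (p == 0%N).
  have f1 : (1 : R) <= (2 * p)`!%:R by rewrite ler1n fact_gt0.
  have e1 : (1 : R) <= 2 * expR 2.
    by rewrite -[leLHS]mulr1 ler_pM// ?ler1n// -[leLHS]expR0 ler_expR.
  by rewrite -[leLHS]mulr1 ler_pM.
- move=> k; pose y w := `|Z k w| + `|Z' k w|.
  have my : measurable_fun setT y.
    apply: measurable_funD; apply: measurableT_comp => //;
      [exact: (sgZ k).1|exact: (sgZ' k).1].
  apply: (@le_trans _ _ (\int[P]_w ((2 * p)`!%:R%:E * (expR (1 * y w))%:E))%E).
    apply: ge0_le_integral => //.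
    + by apply/measurable_EFinP; do 2 apply: measurable_funX.
    + apply: measurable_funeM; apply/measurable_EFinP.
      by apply: measurableT_comp => //; exact: measurable_funM.
    + move=> w _; rewrite -EFinM lee_fin mul1r -exprM.
      by apply: expr_le_fact_expR; rewrite addr_ge0.
  rewrite ge0_integralZl//.
  + rewrite EFinM lee_wpmul2l// ?lee_fin//.
    apply: (le_trans (abs_pair_mgf (sgZ k) (sgZ' k) ler01)).
    by rewrite expr1n mulr1.
  + apply/measurable_EFinP.
    by apply: measurableT_comp => //; exact: measurable_funM.
- by rewrite mulr_ge0// exprn_ge0// ltW.
- by move=> y; exact: tangent.
- by rewrite exprn_gt0.
Qed.
End subgaussian.

(** * Cosine coefficients of periodic functions *)

Section fourier.
Context (R : realType).
Implicit Types (f g : R -> R).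

Local Notation I01 g := ((\int[@lebesgue_measure R]_(t in `[0, 1]) g t)%R).

Lemma integrable01 g : continuous g ->
  (@lebesgue_measure R).-integrable `[0, 1]%classic (EFin \o g).
Proof.
move=> cg; apply: continuous_compact_integrable; first exact: segment_compact.
exact: continuous_subspaceT.
Qed.

Lemma is_derive_continuous f (df : R -> R) :
  (forall x : R, is_derive x 1 f (df x)) -> continuous f.
Proof.
by move=> Hf x; apply/differentiable_continuous/derivable1_diffP; have [] := Hf x.
Qed.

Lemma integral01_derive (F f : R -> R) : (forall x : R, is_derive x 1 F (f x)) ->
  continuous f -> I01 f = F 1 - F 0.
Proof.
move=> dF cf; have cF := is_derive_continuous dF.
rewrite /Rintegral (@continuous_FTC2 _ f F)//=.
- exact: continuous_subspaceT.
- split; first by move=> x _; have [] := dF x.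
  + exact/cvg_at_right_filter/cF.
  + exact/cvg_at_left_filter/cF.
- by move=> x _; rewrite derive1E derive_val.
Qed.

Lemma is_derive_cosM (w x : R) :
  is_derive x 1 (fun t => cos (w * t)) (- w * sin (w * x)).
Proof.
have wx : is_derive x 1 (fun t => w * t) w.
  by apply: (is_derive_eq (is_deriveZ w (is_derive_id x 1))); rewrite scaler1.
apply: (is_derive_eq (is_derive1_comp (is_derive_cos (w * x)) wx)).
by rewrite /= mulNr mulrC mulNr.
Qed.

Lemma is_derive_sinM (w x : R) :
  is_derive x 1 (fun t => sin (w * t)) (w * cos (w * x)).
Proof.
have wx : is_derive x 1 (fun t => w * t) w.
  by apply: (is_derive_eq (is_deriveZ w (is_derive_id x 1))); rewrite scaler1.
apply: (is_derive_eq (is_derive1_comp (is_derive_sin (w * x)) wx)).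
by rewrite /= mulrC.
Qed.

Lemma freqS_periodic k : freq R k = (pi *+ 2) *+ k.
Proof. by rewrite /freq -mulrnA -[RHS]mulr_natr natrM; ring. Qed.

Lemma cosD_freq x k : cos (x + freq R k) = cos x.
Proof. by rewrite freqS_periodic periodicn//; exact: cosD2pi. Qed.

Lemma sinD_freq x k : sin (x + freq R k) = sin x.
Proof. by rewrite freqS_periodic periodicn//; exact: sinD2pi. Qed.

Lemma cos_freq k : cos (freq R k) = 1.
Proof. by rewrite -[freq R k]add0r cosD_freq cos0. Qed.

Lemma sin_freq k : sin (freq R k) = 0.
Proof. by rewrite -[freq R k]add0r sinD_freq sin0. Qed.

Lemma freq_gt0 k : (0 < k)%N -> 0 < freq R k.
Proof. by move=> k0; rewrite /freq !mulr_gt0 ?pi_gt0// ltr0n. Qed.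

Lemma freqD k l : freq R (k + l) = freq R k + freq R l.
Proof. by rewrite /freq natrD mulrDr. Qed.

Lemma continuous_cosM w : continuous (fun t : R => cos (w * t)).
Proof. exact: is_derive_continuous (is_derive_cosM w). Qed.

Lemma continuous_scale (a : R) f : continuous f -> continuous (fun t => a * f t).
Proof.
by move=> cf x; apply: (@continuousM _ _ (cst a) f x _ (cf x)); exact: cst_continuous.
Qed.

Lemma continuous_add f g : continuous f -> continuous g ->
  continuous (fun t => f t + g t).
Proof. by move=> cf cg x; exact: continuousD (cf x) (cg x). Qed.

Lemma continuous_mul f g : continuous f -> continuous g ->
  continuous (fun t => f t * g t).
Proof. by move=> cf cg x; exact: continuousM (cf x) (cg x). Qed.

Lemma integral01D f g : continuous f -> continuous g ->
  I01 (fun t => f t + g t) = I01 f + I01 g.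
Proof. by move=> cf cg; apply: RintegralD => //; exact: integrable01. Qed.

Lemma integral01Z (a : R) f : continuous f -> I01 (fun t => a * f t) = a * I01 f.
Proof. by move=> cf; apply: RintegralZl => //; exact: integrable01. Qed.

Lemma continuous_sum_nat (N : nat) (F : nat -> R -> R) : (forall l, continuous (F l)) ->
  continuous (fun t => \sum_(1 <= l < N) F l t).
Proof.
move=> cF; elim: N => [|[|N] IH].
- rewrite (_ : (fun _ => _) = cst 0); first by move=> x; exact: cst_continuous.
  by apply/funext => t; rewrite big_geq.
- rewrite (_ : (fun _ => _) = cst 0); first by move=> x; exact: cst_continuous.
  by apply/funext => t; rewrite big_geq.
- rewrite (_ : (fun _ => _) = (fun t => \sum_(1 <= l < N.+1) F l t + F N.+1 t)).
    by move=> x; apply: continuousD; [exact: IH|exact: cF].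
  by apply/funext => t; rewrite big_nat_recr.
Qed.

Lemma integral01_sum (N : nat) (F : nat -> R -> R) : (forall l, continuous (F l)) ->
  I01 (fun t => \sum_(1 <= l < N) F l t) = \sum_(1 <= l < N) I01 (F l).
Proof.
move=> cF; elim: N => [|[|N] IH].
- rewrite big_geq// /Rintegral; under eq_integral do rewrite big_geq//.
  by rewrite integral0.
- rewrite big_geq// /Rintegral; under eq_integral do rewrite big_geq//.
  by rewrite integral0.
- rewrite big_nat_recr//= -IH -integral01D//; last exact: continuous_sum_nat.
  by apply: eq_Rintegral => t _; rewrite big_nat_recr.
Qed.

Lemma integral01_cos k : (0 < k)%N -> I01 (fun t => cos (freq R k * t)) = 0.
Proof.
move=> k0; have w0 : freq R k != 0 by rewrite gt_eqF// freq_gt0.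
transitivity ((freq R k)^-1 * sin (freq R k * 1) -
              (freq R k)^-1 * sin (freq R k * 0)).
  apply: (@integral01_derive (fun t => (freq R k)^-1 * sin (freq R k * t))).
  - move=> x; apply: (is_derive_eq (is_deriveZ _ (is_derive_sinM (freq R k) x))).
    by rewrite /GRing.scale/= mulKf.
  - exact: continuous_cosM.
by rewrite mulr1 mulr0 sin_freq sin0 !mulr0 subrr.
Qed.

Lemma integral01_1 : I01 (fun _ => 1) = 1.
Proof.
rewrite Rintegral_cst//= lebesgue_measure_itv/= lte_fin ltr01 mul1r.
by rewrite oppr0 adde0.
Qed.

Lemma cos_mul (a b : R) : cos a * cos b = 2^-1 * (cos (a + b) + cos (a - b)).
Proof. by rewrite cosD cosB; field. Qed.

Lemma cos_orthogonal k l : (0 < k)%N -> (0 < l)%N ->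
  I01 (fun t => cos (freq R k * t) * cos (freq R l * t)) = 2^-1 * (k == l)%:R.
Proof.
wlog kl : k l / (k <= l)%N => [H k0 l0|k0 l0].
  have [kl|/ltnW lk] := leqP k l; first exact: H.
  by rewrite eq_sym -H//; apply: eq_Rintegral => t _; rewrite mulrC.
transitivity (I01 (fun t => 2^-1 * (cos (freq R (l + k) * t) + cos (freq R (l - k) * t)))).
  have fB : freq R (l - k) = freq R l - freq R k.
    by rewrite -[in RHS](subnK kl) freqD addrK.
  by apply: eq_Rintegral => t _; rewrite mulrC cos_mul -mulrDl -mulrBl freqD fB.
rewrite integral01Z; last first.
  by move=> x; apply: continuousD; exact: continuous_cosM.
rewrite integral01D; [|exact: continuous_cosM..].
rewrite integral01_cos ?addn_gt0 ?k0 ?orbT// add0r.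
have [->|kl'] := eqVneq k l; last first.
  by rewrite integral01_cos// subn_gt0 ltn_neqAle kl'.
rewrite subnn; congr (_ * _); apply: (etrans _ integral01_1).
by apply: eq_Rintegral => t _; rewrite /freq mulr0 mul0r cos0.
Qed.

Lemma derive1_periodic f : (forall x : R, derivable f x 1) -> one_periodic f ->
  one_periodic f^`()%classic.
Proof.
move=> df pf x.
have dx1 : is_derive (x + 1) 1 f (f^`()%classic (x + 1)).
  by rewrite derive1E; exact: derivableP.
have dsh : is_derive x 1 (shift (1 : R)) 1 by exact: is_derive_shift.
have := @is_derive1_comp R f (shift 1) x _ _ dx1 dsh; rewrite mulr1.
rewrite (_ : f \o _ = f); last by apply/funext => y /=; exact: pf.
by rewrite [in RHS]derive1E => H; rewrite derive_val.
Qed.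

(** Two integrations by parts at once: f'' cos(wt) + w^2 f cos(wt) is the
derivative of f' cos(wt) + w f sin(wt), a function of period 1. *)
Lemma integral01_derive2_cos f k :
  twice_continuously_differentiable f -> one_periodic f ->
  I01 (fun t => f^`(2)%classic t * cos (freq R k * t)) =
  - freq R k ^+ 2 * I01 (fun t => f t * cos (freq R k * t)).
Proof.
move=> [df d2f c2f] pf; set w := freq R k.
have Df (x : R) : is_derive x 1 f (f^`()%classic x).
  by rewrite derive1E; exact: derivableP.
have D2f (x : R) : is_derive x 1 f^`()%classic (f^`(2)%classic x).
  by rewrite derive1nS derive1n1 derive1E; exact: derivableP.
have cf := is_derive_continuous Df.
have c1 : continuous (fun t => f^`(2)%classic t * cos (w * t)).
  exact: (continuous_mul c2f (@continuous_cosM w)).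
have c0 : continuous (fun t => f t * cos (w * t)).
  exact: (continuous_mul cf (@continuous_cosM w)).
have cZ : continuous (fun t => w ^+ 2 * (f t * cos (w * t))).
  exact: continuous_scale.
apply/eqP; rewrite mulNr -addr_eq0 -(integral01Z _ c0) -(integral01D c1 cZ); apply/eqP.
transitivity ((f^`()%classic 1 * cos (w * 1) + w * (f 1 * sin (w * 1))) -
              (f^`()%classic 0 * cos (w * 0) + w * (f 0 * sin (w * 0)))).
  apply: (@integral01_derive
    (fun t => f^`()%classic t * cos (w * t) + w * (f t * sin (w * t)))).
    move=> x; apply: (is_derive_eq (is_deriveD
      (is_deriveM (D2f x) (is_derive_cosM w x))
      (is_deriveZ w (is_deriveM (Df x) (is_derive_sinM w x))))).
    by rewrite /GRing.scale/=; ring.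
  exact: (continuous_add c1 cZ).
rewrite !mulr1 !mulr0 sin_freq cos_freq sin0 cos0 !mulr0 !addr0 !mulr1.
by rewrite -[X in f^`()%classic X]add0r derive1_periodic// subrr.
Qed.

(** Bessel inequality for f'', whose cosine coefficients are those of f times
- w^2. It is the nonnegativity of the integral of the square of f'' minus its
cosine partial sum. *)
Lemma bessel rho C0 f N : class_F rho C0 f ->
  \sum_(1 <= l < N) freq R l ^+ 4 * fcoef f l ^+ 2 <= C0.
Proof.
move=> [[_ pf _] [tcd _]]; apply: le_trans.
have [df d2f c2f] := tcd.
pose I l := I01 (fun t => f t * cos (freq R l * t)).
(* the Fourier coefficient of minus the second derivative *)
pose a l := 2 * freq R l ^+ 2 * I l.
pose c l t := cos (freq R l * t).
have cc l : continuous (c l) by exact: continuous_cosM.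
have fE l : freq R l ^+ 4 * fcoef f l ^+ 2 = 2 * freq R l ^+ 4 * I l ^+ 2.
  by rewrite /fcoef -/(I l) [(_ * I l) ^+ 2]exprMn sqr_sqrtr// mulrCA mulrA.
have : 0 <= I01 (fun t => (f^`(2)%classic t + \sum_(1 <= l < N) a l * c l t) ^+ 2).
  by apply: Rintegral_ge0 => t _; exact: sqr_ge0.
suff -> : I01 (fun t => (f^`(2)%classic t + \sum_(1 <= l < N) a l * c l t) ^+ 2) =
    L2normsq f^`(2)%classic - \sum_(1 <= l < N) freq R l ^+ 4 * fcoef f l ^+ 2.
  by rewrite subr_ge0.
pose F l t := 2 * a l * (f^`(2)%classic t * c l t).
pose G l m t := a l * a m * (c l t * c m t).
transitivity (I01 (fun t => f^`(2)%classic t ^+ 2 +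
  \sum_(1 <= l < N) (F l t + \sum_(1 <= m < N) G l m t))).
  apply: eq_Rintegral => t _; rewrite sqrrD -addrA; congr (_ + _).
  rewrite big_split; congr (_ + _).
    rewrite mulr_sumr -sumrMnl; apply: eq_bigr => l _.
    by rewrite /F; ring.
  rewrite expr2 mulr_suml; apply: eq_bigr => l _.
  by rewrite mulr_sumr; apply: eq_bigr => m _; rewrite /G; ring.
have cFc l : continuous (fun t => f^`(2)%classic t * c l t).
  exact: continuous_mul.
have ccc l m : continuous (fun t => c l t * c m t).
  exact: continuous_mul.
have cF l : continuous (F l).
  exact: continuous_scale.
have cG l m : continuous (G l m).
  exact: continuous_scale.
have cSG l : continuous (fun t => \sum_(1 <= m < N) G l m t).
  exact: continuous_sum_nat.
have cFG l : continuous (fun t => F l t + \sum_(1 <= m < N) G l m t).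
  exact: continuous_add.
rewrite integral01D; last 2 first.
- exact: (continuous_mul c2f c2f).
- exact: continuous_sum_nat.
congr (_ + _); rewrite integral01_sum// -sumrN.
rewrite !big_nat; apply: eq_bigr => l /andP[l1 lN].
rewrite integral01D// integral01_sum// /F integral01Z// integral01_derive2_cos// -/(I l).
rewrite (eq_big_nat _ _ (F2 := fun m => a l * a m * (2^-1 * (l == m)%:R))); last first.
  by move=> m /andP[m1 _]; rewrite /G integral01Z// cos_orthogonal.
rewrite (bigD1_seq l) ?mem_index_iota ?l1 ?lN ?iota_uniq//=.
rewrite big1; last by move=> m ml; rewrite eq_sym (negbTE ml) !mulr0.
by rewrite eqxx fE /a mulr1n; move: (freq R l) (I l) => w u; field.
Qed.
End fourier.

(** * Aliasing on the design *)

Section aliasing.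
Context (R : realType).
Implicit Types (f : R -> R).

Lemma nat_le_freq k : k%:R <= freq R k.
Proof.
have p1 : 1 <= 2 * pi :> R by have := pi_ge2 R; lra.
by rewrite /freq -[leLHS]mul1r ler_wpM2r.
Qed.

Lemma sum_inv_sqr_le N : \sum_(1 <= l < N) (l%:R ^+ 2)^-1 <= 2 :> R.
Proof.
suff H n : \sum_(1 <= l < n.+2) (l%:R ^+ 2)^-1 <= 2 - n.+1%:R^-1 :> R.
  case: N => [|[|N]]; [by rewrite big_geq..|].
  by apply: (le_trans (H N)); rewrite gerBl invr_ge0.
elim: n => [|n IH]; first by rewrite big_nat1 expr1n !invr1; lra.
rewrite big_nat_recr//=; set S := \sum_(_ <= _ < _) _ in IH *.
suff H : (n.+2%:R ^+ 2)^-1 <= n.+1%:R^-1 - n.+2%:R^-1 :> R.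
  by apply: (le_trans (lerD IH H)); rewrite addrA subrK.
have -> : n.+1%:R^-1 - n.+2%:R^-1 = (n.+1%:R * n.+2%:R)^-1 :> R.
  have := ltr0Sn R n; rewrite -[n.+2%:R]natr1; move: n.+1%:R => x x0.
  by field; rewrite !gt_eqF// addr_gt0.
by rewrite lef_pV2 ?posrE ?mulr_gt0 ?exprn_gt0 ?ltr0n// expr2 ler_pM2r ?ltr0n// ler_nat.
Qed.

Lemma sum_pow4_fcoef_le rho C0 f N : class_F rho C0 f ->
  \sum_(1 <= l < N) l%:R ^+ 4 * fcoef f l ^+ 2 <= C0.
Proof.
move=> Ff; apply: le_trans (bessel N Ff).
apply: ler_sum => l _; rewrite ler_wpM2r ?sqr_ge0// lerXn2r// ?nnegrE//.
  by apply: le_trans (nat_le_freq l).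
exact: nat_le_freq.
Qed.

Definition coef_mass (C0 : R) : R := (2 + C0) / 2.

(** Cauchy-Schwarz in the form of l |f_l| <= (l^-2 + l^4 f_l^2) / 2. This is where
two derivatives of f are spent: the linear noise term has weights of bounded
total mass. *)
Lemma sum_abs_fcoef_le rho C0 f N : class_F rho C0 f ->
  \sum_(1 <= l < N) l%:R * `|fcoef f l| <= coef_mass C0.
Proof.
rewrite /coef_mass => Ff; have b1 := sum_pow4_fcoef_le N Ff; have b2 := sum_inv_sqr_le N.
apply: (@le_trans _ _ (\sum_(1 <= l < N)
    (2^-1 * ((l%:R ^+ 2)^-1 + l%:R ^+ 4 * fcoef f l ^+ 2)))); last first.
  by rewrite -mulr_sumr big_split/=; lra.
rewrite big_nat [leRHS]big_nat; apply: ler_sum => l /andP[l1 _].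
have l0 : 0 < l%:R :> R by rewrite ltr0n.
rewrite -[fcoef f l ^+ 2]real_normK ?num_real//.
set x := `|_|; rewrite -subr_ge0.
rewrite (_ : _ - _ = 2^-1 * (l%:R^-1 - l%:R ^+ 2 * x) ^+ 2).
  by rewrite mulr_ge0 ?invr_ge0 ?sqr_ge0.
by field; rewrite gt_eqF.
Qed.

(** Multiplied by 2 sin(a / 2), where a is the step of the phase, the sum
telescopes. *)
Lemma sum_cos_grid n m (phi : R) : (0 < m < n)%N ->
  \sum_(i < n) cos (freq R m * (i.+1%:R / n%:R) + phi) = 0.
Proof.
move=> /andP[m0 mn]; have n0 : n%:R != 0 :> R by rewrite pnatr_eq0; case: n mn.
have n_gt0 : 0 < n%:R :> R by rewrite ltr0n; case: n mn {n0}.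
pose a := freq R m / n%:R.
pose g (i : nat) := sin (a * i%:R + a / 2 + phi).
have sa : 0 < sin (a / 2).
  apply: sin_gt0_pi; have p0 := pi_gt0 R.
  rewrite (_ : a / 2 = pi * (m%:R / n%:R)); last by rewrite /a /freq; field.
  rewrite mulr_gt0 ?divr_gt0 ?(ltr0n _ m)//=.
  by rewrite gtr_pMr// ltr_pdivrMr// mul1r ltr_nat.
suff H : 2 * sin (a / 2) * \sum_(i < n) cos (freq R m * (i.+1%:R / n%:R) + phi) = 0.
  by apply/eqP; move/eqP: H; rewrite !mulf_eq0 pnatr_eq0 (gt_eqF sa).
rewrite mulr_sumr; transitivity (\sum_(0 <= i < n) (g i.+1 - g i)).
  rewrite big_mkord; apply: eq_bigr => i _; rewrite /g.
  set b := freq R m * _ + phi.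
  rewrite (_ : a * i.+1%:R + a / 2 + phi = b + a / 2); last by rewrite /b /a; field.
  rewrite (_ : a * i%:R + a / 2 + phi = b - a / 2); last first.
    by rewrite /b /a -natr1; field.
  by rewrite sinD sinB; ring.
rewrite telescope_sumr// /g.
rewrite (_ : a * n%:R + a / 2 + phi = a * 0%:R + a / 2 + phi + freq R m); last first.
  by rewrite /a; field.
by rewrite sinD_freq subrr.
Qed.

Definition grid_avg n (u : 'I_n -> R) := n%:R^-1 * \sum_(i < n) u i.

Lemma grid_avg_cos_cos n k l (phi th : R) : (0 < k)%N -> (0 < l)%N -> (k + l < n)%N ->
  grid_avg (fun i : 'I_n => cos (freq R k * design R i - phi) *
                            cos (freq R l * (design R i - th)))
  = 2^-1 * ((l == k)%:R * cos (phi - freq R k * th)).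
Proof.
move=> k0 l0 kln.
have n0 : n%:R != 0 :> R by rewrite pnatr_eq0; case: n kln.
rewrite /grid_avg; under eq_bigr do rewrite cos_mul.
rewrite -mulr_sumr big_split/= mulrCA; congr (_ * _).
rewrite (eq_bigr (fun i : 'I_n =>
    cos (freq R (k + l) * (i.+1%:R / n%:R) + (- phi - freq R l * th)))); last first.
  by move=> i _; rewrite freqD /design; congr cos; ring.
rewrite sum_cos_grid ?add0r ?kln ?addn_gt0 ?k0//.
have [lk|kl|->] := ltngtP l k; rewrite ?mul0r ?mul1r.
- rewrite (eq_bigr (fun i : 'I_n =>
      cos (freq R (k - l) * (i.+1%:R / n%:R) + (freq R l * th - phi)))); last first.
    move=> i _; rewrite /design -[in freq R k](subnK (ltnW lk)) freqD; congr cos; ring.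
  rewrite sum_cos_grid ?mulr0// subn_gt0 lk/=.
  by rewrite (leq_ltn_trans _ kln)// (leq_trans (leq_subr _ _))// leq_addr.
- rewrite (eq_bigr (fun i : 'I_n =>
      cos (freq R (l - k) * (i.+1%:R / n%:R) + (phi - freq R l * th)))); last first.
    move=> i _; rewrite /design -[in freq R l](subnK (ltnW kl)) freqD -[LHS]cosN; congr cos; ring.
  rewrite sum_cos_grid ?mulr0// subn_gt0 kl/=.
  by rewrite (leq_ltn_trans _ kln)// (leq_trans (leq_subr _ _))// leq_addl.
rewrite (eq_bigr (fun i : 'I_n => cos (phi - freq R k * th))); last first.
  by move=> i _; rewrite -[LHS]cosN; congr cos; ring.
by rewrite sumr_const card_ord -[cos _ *+ n]mulr_natl mulKf.
Qed.

Lemma norm_grid_avg_le1 n (u : 'I_n -> R) : (forall i, `|u i| <= 1) ->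
  `|grid_avg u| <= 1.
Proof.
move=> u1; rewrite /grid_avg; case: n u u1 => [|n] u u1.
  by rewrite big_ord0 mulr0 normr0.
rewrite normrM ger0_norm ?invr_ge0// mulrC ler_pdivrMr ?ltr0n// mul1r.
apply: (le_trans (ler_norm_sum _ _ _)).
apply: (@le_trans _ _ (\sum_(i < n.+1) 1)); first by apply: ler_sum => i _.
by rewrite sumr_const card_ord.
Qed.

Lemma norm_cosM_le1 (a b : R) : `|cos a * cos b| <= 1.
Proof.
by rewrite normrM -[leRHS]mulr1 ler_pM// cos_max.
Qed.

Lemma sqrt2_le : Num.sqrt 2 <= 3 / 2 :> R.
Proof.
rewrite -(@ler_pXn2r _ 2)// ?nnegrE ?sqrtr_ge0 ?sqr_sqrtr//; lra.
Qed.

(** Discrete orthogonality is exact for frequencies with k + l < n. For the other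
ones the trivial bound 3 |f_l| suffices, since then 1 <= (k + l) / n <= 2 k l / n;
the factor l is absorbed by the summability of l |f_l|. *)
Lemma alias_term_le n f k l (phi th : R) : (0 < k)%N -> (0 < l)%N -> (0 < n)%N ->
  `| Num.sqrt 2 * fcoef f l * grid_avg (fun i : 'I_n =>
        cos (freq R k * design R i - phi) * cos (freq R l * (design R i - th)))
     - Num.sqrt 2 / 2 * fcoef f l * ((l == k)%:R * cos (phi - freq R k * th)) |
  <= 6 * k%:R / n%:R * (l%:R * `|fcoef f l|).
Proof.
move=> k0 l0 n0; have s2 := sqrt2_le; have s20 := sqrtr_ge0 (2 : R).
have rhs0 : 0 <= 6 * k%:R / n%:R * (l%:R * `|fcoef f l|).
  by rewrite !mulr_ge0 ?invr_ge0.
have [kln|nkl] := ltnP (k + l) n.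
  rewrite grid_avg_cos_cos// (_ : _ - _ = 0) ?normr0//.
  by field.
set G := grid_avg _; have G1 : `|G| <= 1.
  by apply: norm_grid_avg_le1 => i; exact: norm_cosM_le1.
set c := _%:R * cos _; have c1 : `|c| <= 1.
  rewrite /c normrM -[leRHS]mulr1 ler_pM ?cos_max//.
  by case: (l == k); rewrite ?normr1 ?normr0.
apply: (@le_trans _ _ (3 * `|fcoef f l|)).
  rewrite (_ : _ - _ = fcoef f l * (Num.sqrt 2 * G - Num.sqrt 2 / 2 * c)); last by ring.
  rewrite normrM mulrC ler_wpM2r//; apply: (le_trans (ler_normB _ _)).
  have -> : `|Num.sqrt 2 * G| = Num.sqrt 2 * `|G| by rewrite normrM ger0_norm.
  have -> : `|Num.sqrt 2 / 2 * c| = Num.sqrt 2 / 2 * `|c|.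
    by rewrite normrM ger0_norm// divr_ge0.
  by move: G1 c1; have := normr_ge0 G; have := normr_ge0 c; nra.
rewrite mulrA ler_wpM2r// mulrAC ler_pdivlMr ?ltr0n//.
have : (n%:R : R) <= (2 * (k * l))%:R by rewrite ler_nat; nia.
by rewrite natrM natrM; lra.
Qed.

(** On the grid the cosine coefficients of the shifted signal are the true ones
up to O(k / n). The estimate is proved for the partial sums of the cosine
expansion and passes to the limit. *)
Lemma design_cos_avg rho C0 f n k (phi th : R) : class_F rho C0 f ->
  (0 < k)%N -> (0 < n)%N ->
  `| grid_avg (fun i : 'I_n =>
        cos (freq R k * design R i - phi) * f (design R i - th))
     - Num.sqrt 2 / 2 * fcoef f k * cos (phi - freq R k * th) |
  <= 3 * (2 + C0) * k%:R / n%:R.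
Proof.
move=> Ff k0 n0; set D := grid_avg _; set mn := _ * cos _.
pose u N := \sum_(1 <= l < N) Num.sqrt 2 * fcoef f l * grid_avg (fun i : 'I_n =>
        cos (freq R k * design R i - phi) * cos (freq R l * (design R i - th))).
have cexp : cosine_expansion f by case: Ff => -[].
have cvgu : u N @[N --> \oo] --> D.
  rewrite (_ : u = fun N => n%:R^-1 * \sum_(i < n)
    cos (freq R k * design R i - phi) * (Num.sqrt 2 *
      \sum_(1 <= l < N) fcoef f l * cos (freq R l * (design R i - th)))).
    apply: cvgM; first exact: cvg_cst.
    apply: cvg_big => [|i _]; first exact: add_continuous.
    by apply: cvgM; [exact: cvg_cst|exact: cexp].
  apply/funext => N; rewrite /u /grid_avg.
  under eq_bigr do rewrite mulrCA mulr_sumr.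
  rewrite -mulr_sumr exchange_big/=; congr (_ * _); apply: eq_bigr => i _.
  by rewrite !mulr_sumr; apply: eq_bigr => l _; ring.
have cvgd : `|u N - mn| @[N --> \oo] --> `|D - mn|.
  by apply: cvg_norm; apply: cvgB => //; exact: cvg_cst.
apply: (cvgr_to_le cvgd).
near=> N.
have kN : (k < N)%N by near: N; exact: nbhs_infty_gt.
have -> : mn = \sum_(1 <= l < N)
    Num.sqrt 2 / 2 * fcoef f l * ((l == k)%:R * cos (phi - freq R k * th)).
  rewrite (bigD1_seq k) ?mem_index_iota ?k0 ?kN ?iota_uniq//=.
  rewrite eqxx mul1r big1 ?addr0// => l /negbTE ->.
  by rewrite mul0r mulr0.
rewrite /u -sumrB; apply: (le_trans (ler_norm_sum _ _ _)).
apply: (@le_trans _ _ (\sum_(1 <= l < N) 6 * k%:R / n%:R * (l%:R * `|fcoef f l|))).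
  by rewrite big_nat [leRHS]big_nat; apply: ler_sum => l /andP[l1 _]; exact: alias_term_le.
rewrite -mulr_sumr.
have := sum_abs_fcoef_le N Ff; rewrite /coef_mass; set S := \sum_(_ <= _ < _) _ => SA.
apply: (@le_trans _ _ (6 * k%:R / n%:R * ((2 + C0) / 2))).
  by rewrite ler_wpM2l// !mulr_ge0 ?invr_ge0.
by rewrite le_eqVlt; apply/orP; left; apply/eqP; field; rewrite pnatr_eq0 -lt0n.
Unshelve. all: by end_near.
Qed.
End aliasing.

(** * Curvature of the criterion *)

Section deterministic.
Context (R : realType).

Lemma lipschitz1 (f df : R -> R) : (forall x : R, is_derive x 1 f (df x)) ->
  (forall x, `|df x| <= 1) -> forall a b, `|f a - f b| <= `|a - b|.
Proof.
move=> Df df1 a b; wlog ab : a b / b <= a => [H|].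
  have [|/ltW] := leP b a; first exact: H.
  by rewrite (distrC (f a)) (distrC a); exact: H.
have [x _ ->] := MVT_segment ab (fun x _ => Df x)
  (continuous_subspaceT (is_derive_continuous Df)).
by rewrite normrM ler_piMl.
Qed.

Lemma cos_lipschitz (a b : R) : `|cos a - cos b| <= `|a - b|.
Proof.
apply: (lipschitz1 (df := fun x => - sin x)) => x.
by rewrite normrN sin_max.
Qed.

Lemma sin_lipschitz (a b : R) : `|sin a - sin b| <= `|a - b|.
Proof.
by apply: (lipschitz1 (df := cos)) => x; exact: cos_max.
Qed.

Lemma cos_ge (b x : R) : 0 <= b -> b <= pi -> 0 <= x <= b -> cos b <= cos x.
Proof.
move=> b0 bpi /andP[x0]; rewrite le_eqVlt => /predU1P[->//|xb].
by rewrite ltW// ltr_cos// in_itv/= ?b0 ?x0//= (le_trans (ltW xb)).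
Qed.

(** The double-angle formula gives sin(2 pi x) = 2 cos(pi x) sin(pi x), and both
factors are controlled by the cosine at the endpoint, which is positive
because the shifts stay below a quarter of the period. *)
Definition sin_coercivity (tau0 : R) : R := (2 * pi * cos (2 * pi * tau0) ^+ 2) ^+ 2.

Lemma cos_2pi_tau0_gt0 (tau0 : R) : 0 < tau0 -> tau0 < 1 / 4 -> 0 < cos (2 * pi * tau0).
Proof.
move=> t0 t4; have p0 := pi_gt0 R; apply: cos_gt0_pihalf.
by apply/andP; split; nra.
Qed.

Lemma sin_coercivity_gt0 (tau0 : R) : 0 < tau0 -> tau0 < 1 / 4 -> 0 < sin_coercivity tau0.
Proof.
move=> t0 t4; have p0 := pi_gt0 R; have c0 := cos_2pi_tau0_gt0 t0 t4.
by rewrite /sin_coercivity exprn_gt0// mulr_gt0 ?exprn_gt0// mulr_gt0.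
Qed.

Lemma sin_coercive (tau0 x : R) : 0 < tau0 -> tau0 < 1 / 4 -> `|x| <= 2 * tau0 ->
  sin_coercivity tau0 * x ^+ 2 <= sin (2 * pi * x) ^+ 2.
Proof.
move=> t0 t4; wlog x0 : x / 0 <= x => [H|].
  have [|/ltW x0] := leP 0 x; first exact: H.
  by have := H (- x); rewrite oppr_ge0 normrN sqrrN mulrN sinN sqrrN; exact.
rewrite ger0_norm// => xt; have p0 := pi_gt0 R.
have c0 := cos_2pi_tau0_gt0 t0 t4; set b := 2 * pi * tau0 in c0 *.
set y := pi * x; have y0 : 0 <= y by rewrite mulr_ge0// ltW.
have yb : y <= b by rewrite /y /b; nra.
have b0 : 0 <= b by exact: le_trans yb.
have bpi : b <= pi by rewrite /b; nra.
have cy : cos b <= cos y by apply: cos_ge => //; rewrite y0.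
have sy : y * cos b <= sin y.
  have [z zy] := MVT_segment y0 (fun z _ => is_derive_sin z)
    (continuous_subspaceT (@continuous_sin R)).
  rewrite sin0 !subr0 => ->; rewrite mulrC ler_wpM2r//.
  move: zy; rewrite in_itv/= => /andP[z0 zy]; apply: cos_ge => //.
  by rewrite z0 (le_trans zy).
have -> : sin (2 * pi * x) = 2 * (cos y * sin y).
  rewrite (_ : 2 * pi * x = y *+ 2) ?sin_mulr2n ?mulr_natl//.
  by rewrite /y; ring.
have yc0 : 0 <= y * cos b by rewrite mulr_ge0// ltW.
have le12 : 2 * pi * cos b ^+ 2 * x <= 2 * (cos y * sin y).
  rewrite (_ : _ * x = 2 * (cos b * (y * cos b))); last by rewrite /y; ring.
  by rewrite ler_wpM2l// ler_pM// ltW.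
have ge1 : 0 <= 2 * pi * cos b ^+ 2 * x.
  by rewrite !mulr_ge0// ltW.
rewrite /sin_coercivity -/b -exprMn lerXn2r// nnegrE.
exact: le_trans le12.
Qed.

(** The increment of one term of the criterion when the shift moves by [d]. The
errors [E] and [E0] are trigonometric in the shift, so their difference is
O(w d r), and so is cos(w d) - 1: every error term carries a factor [`|d|]. *)
Lemma criterion_term_increment (w d g E E0 r : R) :
  `|E| <= r -> `|E0| <= r -> `|E - E0| <= w * `|d| * r -> 0 <= w ->
  (g * cos (w * d) + E) ^+ 2 - (g + E0) ^+ 2 <=
  - (g ^+ 2 * sin (w * d) ^+ 2) + `|d| * (w * (4 * `|g| * r + 2 * r ^+ 2)).
Proof.
move=> Er E0r EE0 w0; set c := cos (w * d).
have r0 : 0 <= r by exact: le_trans Er.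
have c1 : `|c - 1| <= w * `|d|.
  rewrite -[1]cos0; apply: (le_trans (cos_lipschitz _ _)).
  by rewrite subr0 normrM [ `|w| ]ger0_norm.
rewrite sin2cos2 -/c.
rewrite (_ : _ - _ = - (g ^+ 2 * (1 - c ^+ 2)) + 2 * (g * ((c - 1) * E + (E - E0)))
   + (E - E0) * (E + E0)); last by ring.
rewrite -addrA lerD2l.
have t1 : g * ((c - 1) * E + (E - E0)) <= `|g| * (w * `|d| * r + w * `|d| * r).
  apply: (le_trans (ler_norm _)); rewrite normrM ler_wpM2l//.
  apply: (le_trans (ler_normD _ _)); apply: lerD => //.
  by rewrite normrM ler_pM.
have t2 : (E - E0) * (E + E0) <= w * `|d| * r * (r + r).
  apply: (le_trans (ler_norm _)); rewrite normrM ler_pM//.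
  by apply: (le_trans (ler_normD _ _)); exact: lerD.
apply: (le_trans (lerD (ler_wpM2l _ t1) t2)) => //.
by rewrite le_eqVlt; apply/orP; left; apply/eqP; ring.
Qed.

(** If [tau] does at least as well as [theta], the quadratic loss due to the first
frequency is at most [`|tau - theta|] times a sum over the frequencies of error
terms that do not depend on [tau]. Cancelling one factor leaves a bound for
[`|tau - theta|] that holds pointwise, so that no supremum of a random
process has to be controlled. *)
Lemma shift_error_le (tau0 rho : R) (H g e e' : nat -> R) (M : nat) (tau theta : R) :
  let A k t := g k * cos (freq R k * (t - theta)) +
               (cos (freq R k * t) * e k + sin (freq R k * t) * e' k) in
  let r k := `|e k| + `|e' k| in
  0 < rho -> 0 < tau0 -> tau0 < 1 / 4 -> `|tau| <= tau0 -> `|theta| <= tau0 ->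
  (1 < M)%N -> H 1%N = 1 -> (forall k, (1 <= k)%N -> 0 <= H k) ->
  rho / 2 <= g 1%N ^+ 2 ->
  \sum_(1 <= k < M) H k * A k theta ^+ 2 <= \sum_(1 <= k < M) H k * A k tau ^+ 2 ->
  rho / 2 * sin_coercivity tau0 * `|tau - theta| <=
  \sum_(1 <= k < M) H k * (freq R k * (4 * `|g k| * r k + 2 * r k ^+ 2)).
Proof.
move=> A r rho0 t0 t4 tau_le theta_le M1 H1 H0 g1; rewrite -subr_ge0 => HA.
set d := tau - theta; set B := \sum_(_ <= _ < _) _.
have freq0 k : 0 <= freq R k by apply: le_trans (nat_le_freq R k).
have r0 k : 0 <= r k by exact: addr_ge0.
have B0 : 0 <= B.
  rewrite /B big_nat; apply: sumr_ge0 => k /andP[k1 _].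
  rewrite mulr_ge0 ?H0// mulr_ge0// addr_ge0//; first by rewrite mulr_ge0// mulr_ge0.
  by rewrite mulr_ge0// exprn_ge0.
have lin (x y a : R) k : `|x| <= a -> `|y| <= a -> 0 <= a ->
    `|x * e k + y * e' k| <= a * r k.
  move=> xa ya a0; apply: (le_trans (ler_normD _ _)).
  by rewrite !normrM /r mulrDr lerD// ler_wpM2r.
have key : \sum_(1 <= k < M) H k * A k tau ^+ 2 - \sum_(1 <= k < M) H k * A k theta ^+ 2
    <= - (rho / 2 * sin_coercivity tau0 * d ^+ 2) + `|d| * B.
  apply: (@le_trans _ _ (\sum_(1 <= k < M) H k *
     (- (g k ^+ 2 * sin (freq R k * d) ^+ 2)
      + `|d| * (freq R k * (4 * `|g k| * r k + 2 * r k ^+ 2))))).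
    rewrite -sumrB !big_nat; apply: ler_sum => k /andP[k1 _].
    rewrite -mulrBr ler_wpM2l ?H0// /A subrr mulr0 cos0 mulr1.
    apply: criterion_term_increment => //.
    - by rewrite -[leRHS]mul1r lin// ?cos_max ?sin_max.
    - by rewrite -[leRHS]mul1r lin// ?cos_max ?sin_max.
    - rewrite [X in `| X | <= _](_ : _ = (cos (freq R k * tau) - cos (freq R k * theta)) * e k +
        (sin (freq R k * tau) - sin (freq R k * theta)) * e' k); last by ring.
      have wd : freq R k * `|d| = `|freq R k * tau - freq R k * theta|.
        by rewrite -mulrBr normrM [ `|freq R k| ]ger0_norm.
      by rewrite lin ?wd ?cos_lipschitz ?sin_lipschitz.
  rewrite (eq_bigr (fun k => - (H k * (g k ^+ 2 * sin (freq R k * d) ^+ 2)) +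
    `|d| * (H k * (freq R k * (4 * `|g k| * r k + 2 * r k ^+ 2))))); last first.
    by move=> k _; ring.
  rewrite big_split/= -mulr_sumr -/B lerD2r sumrN lerN2.
  rewrite big_ltn// H1 mul1r.
  apply: (@le_trans _ _ (g 1%N ^+ 2 * sin (freq R 1 * d) ^+ 2)).
    have d2 : `|d| <= 2 * tau0.
      by apply: (le_trans (ler_normB _ _)); lra.
    rewrite -mulrA ler_pM//.
    - by rewrite divr_ge0// ltW.
    - by rewrite mulr_ge0 ?sqr_ge0// ltW// sin_coercivity_gt0.
    - by rewrite /freq mulr1 sin_coercive.
  rewrite lerDl big_nat; apply: sumr_ge0 => k /andP[k1 _].
  by rewrite mulr_ge0 ?(mulr_ge0 (sqr_ge0 _) (sqr_ge0 _))// H0// ltnW.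
have := le_trans HA key.
have [->|d0] := eqVneq d 0; first by rewrite normr0 mulr0.
rewrite -[d ^+ 2]real_normK ?num_real// addrC subr_ge0.
have d_gt0 : 0 < `|d| by rewrite normr_gt0.
rewrite expr2 mulrA [leLHS]mulrC ler_pM2l//.
Qed.
End deterministic.

(** * From the coefficients to the error of the estimator *)

Section combine.
Context (R : realType).

Lemma sum1_finite (u : nat -> R) M : (forall k, (M <= k)%N -> u k = 0) ->
  sum1 u = \sum_(1 <= k < M) u k.
Proof.
move=> u0; rewrite /sum1; apply: lim_near_cst => //.
near=> N.
have MN : (M <= N)%N by near: N; exact: nbhs_infty_ge.
have [M1|M1] := leqP 1 M; last first.
  rewrite [RHS]big_geq// 1?ltnW// big1// => k _.
  by apply: u0; move: M1; rewrite ltnS leqn0 => /eqP->.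
rewrite (big_cat_nat (n := M))//= [X in _ + X]big_nat [X in _ + X]big1 ?addr0//.
by move=> k /andP[Mk _]; exact: u0.
Unshelve. all: by end_near. Qed.

Lemma weight_support (h : nat -> nat -> R) n : condC1 h -> (1 <= n)%N ->
  exists2 M, (1 < M)%N & forall k, (M <= k)%N -> h n k = 0.
Proof.
move=> hC1 n1; have /finite_seqP[s sE] := hC1 n n1.
exists (\max_(i <- s) i).+2 => // k kM.
apply/eqP/negPn/negP => hk0.
have : [set` s] k by rewrite -sE; split => //; exact: leq_trans kM.
move=> /= ks; have : (k <= \max_(i <- s) i)%N by exact: leq_bigmax_seq.
by move=> /(leq_trans kM); rewrite ltnNge leqnSn.
Qed.

Lemma sum_indic_le (x : R) M : 0 <= x -> \sum_(1 <= k < M) (k%:R <= x)%R%:R <= x.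
Proof.
move=> x0; elim: M => [|[|M] IH]; [by rewrite big_geq..|].
rewrite big_nat_recr//=; case: (leP M.+1%:R x) => [Mx|_]; last by rewrite addr0.
apply: le_trans Mx; rewrite -natr1 lerD2r.
apply: (@le_trans _ _ (\sum_(1 <= k < M.+1) 1)).
  by apply: ler_sum => k _; rewrite lern1 leq_b1.
by rewrite sumr_const_nat subn1.
Qed.

(** The frequencies up to s^2 contribute at most s^2 . s^2; beyond s^2, k is at most
k^4 / s^6 and the bound on the fourth powers applies. With s^10 = n the two
parts are of the same order. *)
Lemma weight_sum_le (H : nat -> R) (D1 s : R) M n :
  (forall k, (1 <= k)%N -> 0 <= H k <= 1) -> 0 < s -> s ^+ 10 = n%:R ->
  \sum_(1 <= k < M) H k * freq R k ^+ 4 <= D1 * n%:R ->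
  \sum_(1 <= k < M) H k * k%:R <= (1 + D1) * s ^+ 4 /\
  \sum_(1 <= k < M) H k * k%:R ^+ 3 <= D1 * s ^+ 10.
Proof.
move=> H01 s0 sn C3.
have C3' : \sum_(1 <= k < M) H k * k%:R ^+ 4 <= D1 * s ^+ 10.
  rewrite sn; apply: le_trans C3; rewrite big_nat [leRHS]big_nat.
  apply: ler_sum => k /andP[k1 _]; have /andP[Hk0 _] := H01 k k1.
  rewrite ler_wpM2l// lerXn2r// ?nnegrE//; last exact: nat_le_freq.
  by apply: le_trans (nat_le_freq R k).
split; last first.
  apply: le_trans C3'; rewrite big_nat [leRHS]big_nat.
  apply: ler_sum => k /andP[k1 _]; have /andP[Hk0 _] := H01 k k1.
  by rewrite ler_wpM2l// exprS ler_peMl// ?exprn_ge0// ler1n.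
apply: (@le_trans _ _ (\sum_(1 <= k < M)
    (s ^+ 2 * (k%:R <= s ^+ 2)%R%:R + (s ^+ 6)^-1 * (H k * k%:R ^+ 4)))).
  rewrite big_nat [leRHS]big_nat; apply: ler_sum => k /andP[k1 _].
  have /andP[Hk0 Hk1] := H01 k k1; have s6 : 0 < s ^+ 6 by rewrite exprn_gt0.
  case: (leP k%:R (s ^+ 2)) => ks.
    rewrite mulr1; apply: (@le_trans _ _ (s ^+ 2)).
      by apply: le_trans ks; rewrite ler_piMl.
    by rewrite lerDl mulr_ge0 ?invr_ge0 ?(ltW s6)// mulr_ge0// exprn_ge0.
  rewrite mulr0 add0r [leRHS]mulrC ler_pdivlMr// -mulrA ler_wpM2l//.
  rewrite [k%:R ^+ 4]exprS ler_wpM2l// (_ : s ^+ 6 = (s ^+ 2) ^+ 3); last by rewrite -exprM.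
  by rewrite lerXn2r// ?nnegrE ?exprn_ge0// ltW.
rewrite big_split/= -!mulr_sumr mulrDl mul1r lerD//.
  rewrite (_ : s ^+ 4 = s ^+ 2 * s ^+ 2); last by rewrite -exprD.
  by rewrite ler_wpM2l ?sqr_ge0// sum_indic_le// sqr_ge0.
rewrite mulrC ler_pdivrMr ?exprn_gt0//.
by rewrite -mulrA -exprD.
Qed.

(** The phase [phi] is 0 for the cosine coefficient and [pi / 2] for the sine
coefficient. The normalization gives the noise variable variance at most 1. *)
Definition noise_coef (phi : R) n k (i : 'I_n) : R :=
  cos (freq R k * design R i - phi) / Num.sqrt n%:R.

Definition noise_size n (e : 'I_n -> R) k : R :=
  `|\sum_i noise_coef 0 k i * e i| + `|\sum_i noise_coef (pi / 2) k i * e i|.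

Lemma noise_coef_sqr_le1 phi n k : \sum_(i < n) noise_coef phi k i ^+ 2 <= 1.
Proof.
case: n => [|n]; first by rewrite big_ord0.
apply: (@le_trans _ _ (\sum_(i < n.+1) n.+1%:R^-1)).
  apply: ler_sum => i _; rewrite /noise_coef expr_div_n sqr_sqrtr//.
  by rewrite ler_piMl ?invr_ge0//.
by rewrite sumr_const card_ord -[leLHS]mulr_natr mulVf.
Qed.

Lemma fourier_coef_error rho C0 f n (e : 'I_n -> R) k (phi th : R) :
  class_F rho C0 f -> (0 < k)%N -> (0 < n)%N ->
  `| n%:R^-1 * (\sum_(i < n) cos (freq R k * design R i - phi) *
        (f (design R i - th) + e i))
     - Num.sqrt 2 / 2 * fcoef f k * cos (phi - freq R k * th) |
  <= 3 * (2 + C0) * k%:R / n%:R +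
     `|\sum_i noise_coef phi k i * e i| / Num.sqrt n%:R.
Proof.
move=> Ff k0 n0; have := design_cos_avg phi th Ff k0 n0.
rewrite /grid_avg; set D := _^-1 * _; set mn := _ * cos _ => DA.
have n_gt0 : 0 < n%:R :> R by rewrite ltr0n.
have sn : Num.sqrt n%:R ^+ 2 = n%:R :> R by rewrite sqr_sqrtr.
have sn0 : 0 < Num.sqrt n%:R :> R by rewrite sqrtr_gt0.
set W := \sum_i noise_coef _ _ _ * _.
rewrite (_ : _ - mn = (D - mn) + W / Num.sqrt n%:R).
  apply: (le_trans (ler_normD _ _)); apply: lerD => //.
  by rewrite normrM [X in _ * X <= _]ger0_norm ?invr_ge0 ?(ltW sn0).
have -> : W / Num.sqrt n%:R = n%:R^-1 * \sum_(i < n) cos (freq R k * design R i - phi) * e i.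
  rewrite -[X in _ = X^-1 * _]sn mulr_suml mulr_sumr; apply: eq_bigr => i _.
  rewrite /noise_coef; move: (Num.sqrt _) sn0 => q q0.
  by field; rewrite gt_eqF.
rewrite addrAC /D -mulrDr -big_split/=; congr (_ * _ - _).
by apply: eq_bigr => i _; rewrite mulrDr.
Qed.

Definition error_gain (tau0 rho : R) : R := 64 / (rho * sin_coercivity tau0).

Definition alias_const (C0 : R) : R := 6 * (2 + C0).

Definition bias_const (C0 D1 : R) : R :=
  alias_const C0 * (1 + D1 + C0) + alias_const C0 ^+ 2 * D1.

(** The deterministic bound after multiplication by the square root of the sample
size, written with s^10 = n. The aliasing error contributes the first term, of
order 1 / s. The term linear in the noise has weights of bounded mass, whereas
the quadratic one has weights of mass O(s^4) and is divided by s^5. *)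
Lemma scaled_error_le (tau0 rho C0 D1 s : R) f n (H : nat -> R) M
    (e : 'I_n -> R) (th tau : R) :
  let crit t := \sum_(1 <= k < M) H k * (n%:R^-1 *
    \sum_(i < n) cos (freq R k * (design R i - t)) * (f (design R i - th) + e i)) ^+ 2 in
  class_F rho C0 f -> 0 <= C0 -> 0 < rho -> 0 < tau0 -> tau0 < 1 / 4 -> 0 < D1 ->
  `|tau| <= tau0 -> `|th| <= tau0 -> (0 < n)%N -> 1 <= s -> s ^+ 10 = n%:R ->
  (1 < M)%N -> H 1%N = 1 -> (forall k, (1 <= k)%N -> 0 <= H k <= 1) ->
  \sum_(1 <= k < M) H k * freq R k ^+ 4 <= D1 * n%:R ->
  crit th <= crit tau ->
  Num.sqrt n%:R * `|tau - th| <= error_gain tau0 rho *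
    (bias_const C0 D1 / s
     + \sum_(1 <= k < M) H k * (k%:R * `|fcoef f k|) * noise_size e k
     + (\sum_(1 <= k < M) H k * k%:R * noise_size e k ^+ 2) / s ^+ 5).
Proof.
move=> crit; rewrite /error_gain /bias_const; set A := alias_const C0.
move=> Ff C0_ge0 rho0 t0 t4 D0 tau_le th_le n0 s1 sn M1 H1 H01 C3 crit_le.
have s0 : 0 < s by exact: lt_le_trans s1.
have sqn : Num.sqrt n%:R = s ^+ 5.
  by rewrite -sn (exprM s 5 2) sqrtr_sqr ger0_norm// exprn_ge0// ltW.
have H0 k : (1 <= k)%N -> 0 <= H k by move=> /H01/andP[].
pose g k := Num.sqrt 2 / 2 * fcoef f k.
pose a k := n%:R^-1 * (\sum_(i < n) cos (freq R k * design R i) * (f (design R i - th) + e i)).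
pose b k := n%:R^-1 * (\sum_(i < n) sin (freq R k * design R i) * (f (design R i - th) + e i)).
(* the errors made on the cosine and sine coefficients of the shifted signal *)
pose ec k := a k - g k * cos (freq R k * th).
pose es k := b k - g k * sin (freq R k * th).
have aveE k t : n%:R^-1 * \sum_(i < n)
      cos (freq R k * (design R i - t)) * (f (design R i - th) + e i)
    = g k * cos (freq R k * (t - th)) + (cos (freq R k * t) * ec k + sin (freq R k * t) * es k).
  transitivity (cos (freq R k * t) * a k + sin (freq R k * t) * b k).
    rewrite /a /b 2!(mulrCA _ n%:R^-1) -mulrDr; congr (_ * _).
    rewrite !mulr_sumr -big_split; apply: eq_bigr => i _.
    by rewrite mulrBr cosB /= mulrDl !mulrA [cos (freq R k * t) * _]mulrC
      [sin (freq R k * t) * _]mulrC.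
  by rewrite /ec /es mulrBr cosB; ring.
pose z := noise_size e.
pose r k := `|ec k| + `|es k|.
have z0 k : 0 <= z k by rewrite addr_ge0.
have rle k : (1 <= k)%N -> r k <= A * k%:R / s ^+ 10 + z k / s ^+ 5.
  move=> k1; have := fourier_coef_error e 0 th Ff k1 n0.
  have := fourier_coef_error e (pi / 2) th Ff k1 n0.
  rewrite sqn -sn.
  have -> : cos (pi / 2 - freq R k * th) = sin (freq R k * th).
    by rewrite -[LHS]cosN opprB cosBpihalf.
  rewrite sub0r cosN.
  rewrite (eq_bigr
    (fun i => sin (freq R k * design R i) * (f (design R i - th) + e i))); last first.
    by move=> i _; rewrite cosBpihalf.
  rewrite [X in _ -> `|_ * X - _| <= _ -> _](eq_bigr
    (fun i => cos (freq R k * design R i) * (f (design R i - th) + e i))); last first.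
    by move=> i _; rewrite subr0.
  rewrite /r /ec /es /a /b sn /z /noise_size /g => hs hc.
  apply: (le_trans (lerD hc hs)); rewrite le_eqVlt; apply/orP; left; apply/eqP.
  by rewrite /A /alias_const; field; rewrite gt_eqF ?exprn_gt0//= gt_eqF// ltr0n.
have s2 : 0 <= (Num.sqrt 2 / 2 : R) <= 1.
  have sl := sqrt2_le R; have sg := sqrtr_ge0 (2 : R).
  by rewrite divr_ge0//= ler_pdivrMr// mul1r; lra.
have g1 : rho / 2 <= g 1%N ^+ 2.
  have [_ [_ f1 _]] := Ff.
  by rewrite /g exprMn expr_div_n sqr_sqrtr//; lra.
have gf k : `|g k| <= `|fcoef f k|.
  have /andP[s20 s21] := s2.
  by rewrite /g normrM [X in X * _ <= _]ger0_norm// ler_piMl.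
have core := @shift_error_le R tau0 rho H g ec es M tau th rho0 t0 t4 tau_le th_le M1 H1 H0 g1.
have {}core : rho / 2 * sin_coercivity tau0 * `|tau - th| <=
    \sum_(1 <= k < M) H k * (freq R k * (4 * `|g k| * r k + 2 * r k ^+ 2)).
  apply: core; move: crit_le; rewrite /crit.
  under eq_bigr do rewrite aveE.
  by under [leRHS]eq_bigr do rewrite aveE.
have [S1 S3] := weight_sum_le H01 s0 sn C3.
have s4 : 1 <= s ^+ 4 by rewrite exprn_ege1.
have S2 : \sum_(1 <= k < M) H k * (k%:R ^+ 2 * `|fcoef f k|) <= (1 + D1 + C0) * s ^+ 4.
  apply: (@le_trans _ _ (\sum_(1 <= k < M)
      2^-1 * (H k * k%:R + k%:R ^+ 4 * fcoef f k ^+ 2))).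
    rewrite big_nat [leRHS]big_nat; apply: ler_sum => k /andP[k1 _].
    rewrite -[fcoef f k ^+ 2]real_normK ?num_real//.
    have /andP[Hk0 Hk1] := H01 k k1.
    have kk : (1 : R) <= k%:R by rewrite ler1n.
    have Hkk : H k <= H k * k%:R by rewrite ler_peMr.
    have := normr_ge0 (fcoef f k); set x := `|_| => x0.
    have y0 : 0 <= k%:R ^+ 2 * x by rewrite mulr_ge0.
    have -> : k%:R ^+ 4 * x ^+ 2 = (k%:R ^+ 2 * x) ^+ 2 by rewrite exprMn -exprM.
    have := sqr_ge0 (1 - k%:R ^+ 2 * x).
    set y := k%:R ^+ 2 * x in y0 *; set u := H k * k%:R in Hkk *.
    by move: (H k) Hk0 Hk1 Hkk => hk Hk0 Hk1 Hkk; nra.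
  rewrite -mulr_sumr big_split/=; have := sum_pow4_fcoef_le M Ff.
  by move: S1; set S := \sum_(_ <= _ < _) _; set S' := \sum_(_ <= _ < _) _; nra.
set W2 := \sum_(1 <= k < M) H k * (k%:R * `|fcoef f k|) * _.
set W := \sum_(1 <= k < M) H k * k%:R * _.
have A0 : 0 <= A by rewrite mulr_ge0// addr_ge0.
have sV n' : 0 <= (s ^+ n')^-1 by rewrite invr_ge0 exprn_ge0// ltW.
have Tle : \sum_(1 <= k < M) H k * (freq R k * (4 * `|g k| * r k + 2 * r k ^+ 2)) <=
    32 * (A / s ^+ 10 * (\sum_(1 <= k < M) H k * (k%:R ^+ 2 * `|fcoef f k|)) +
     W2 / s ^+ 5 + A ^+ 2 / s ^+ 20 * (\sum_(1 <= k < M) H k * k%:R ^+ 3) + W / s ^+ 10).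
  rewrite /W2 /W !mulr_sumr !mulr_suml -!big_split/= mulr_sumr.
  rewrite big_nat [leRHS]big_nat; apply: ler_sum => k /andP[k1 _].
  have rk := rle k k1; have gk := gf k.
  have rk0 : 0 <= r k by exact: addr_ge0.
  pose alpha := A * k%:R / s ^+ 10; pose beta := z k / s ^+ 5.
  have al0 : 0 <= alpha by rewrite mulr_ge0// mulr_ge0.
  have be0 : 0 <= beta by rewrite mulr_ge0.
  have r2 : r k ^+ 2 <= 2 * (alpha ^+ 2 + beta ^+ 2).
    apply: (@le_trans _ _ ((alpha + beta) ^+ 2)).
      by rewrite lerXn2r// nnegrE// addr_ge0.
    by have := sqr_ge0 (alpha - beta); nra.
  have frk : freq R k <= 8 * k%:R.
    rewrite /freq ler_wpM2r//; have := pihalf_lt2 R; lra.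
  rewrite (_ : 32 * _ = H k * (8 * k%:R * (4 * `|fcoef f k| * (alpha + beta)
      + 2 * (2 * (alpha ^+ 2 + beta ^+ 2))))); last first.
    by rewrite /alpha /beta /z; field; rewrite gt_eqF.
  rewrite ler_wpM2l ?H0// ler_pM//.
  - by apply: le_trans (nat_le_freq R k).
  - by rewrite addr_ge0// mulr_ge0 ?mulr_ge0 ?exprn_ge0.
  apply: lerD; last by rewrite ler_wpM2l.
  by apply: ler_pM => //; rewrite ler_wpM2l.
have kap0 := sin_coercivity_gt0 t0 t4.
have rk0 : 0 < rho * sin_coercivity tau0 by rewrite mulr_gt0.
rewrite sqn [leRHS]mulrAC ler_pdivlMr//.
set B0 := A * _ + _ * _.
have s5T : s ^+ 5 * (32 * (A / s ^+ 10 * (\sum_(1 <= k < M) H k * (k%:R ^+ 2 * `|fcoef f k|)) +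
     W2 / s ^+ 5 + A ^+ 2 / s ^+ 20 * (\sum_(1 <= k < M) H k * k%:R ^+ 3) + W / s ^+ 10))
    <= 32 * (B0 / s + W2 + W / s ^+ 5).
  set X := \sum_(_ <= _ < _) _ in S2 *; set Y := \sum_(_ <= _ < _) _ in S3 *.
  rewrite (_ : s ^+ 5 * _ =
    32 * (A / s ^+ 5 * X + A ^+ 2 / s ^+ 15 * Y + W2 + W / s ^+ 5)); last first.
    by field; rewrite gt_eqF.
  rewrite ler_wpM2l// lerD2r lerD2r.
  apply: (@le_trans _ _ (A / s ^+ 5 * ((1 + D1 + C0) * s ^+ 4) +
    A ^+ 2 / s ^+ 15 * (D1 * s ^+ 10))).
    by apply: lerD; rewrite ler_wpM2l// mulr_ge0// sqr_ge0.
  rewrite /B0 [leRHS]mulrDl; apply: lerD.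
    by rewrite le_eqVlt; apply/orP; left; apply/eqP; field; rewrite gt_eqF.
  rewrite (_ : _ * (D1 * _) = A ^+ 2 * D1 / s ^+ 5); last by field; rewrite gt_eqF.
  rewrite ler_wpM2l//; first by rewrite mulr_ge0 ?sqr_ge0// ltW.
  rewrite lef_pV2 ?posrE ?exprn_gt0//.
  by rewrite exprS ler_peMr ?exprn_ege1// ltW.
apply: (@le_trans _ _ (2 * (s ^+ 5 * (rho / 2 * sin_coercivity tau0 * `|tau - th|)))).
  by rewrite le_eqVlt; apply/orP; left; apply/eqP; field.
apply: (@le_trans _ _ (2 * (32 * (B0 / s + W2 + W / s ^+ 5)))); last first.
  by rewrite mulrA le_eqVlt; apply/orP; left; apply/eqP; ring.
rewrite ler_wpM2l//; apply: le_trans s5T.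
by rewrite ler_wpM2l ?exprn_ge0 ?(ltW s0)// (le_trans core).
Qed.
End combine.

(** * Probability of a large deviation *)

Lemma class_F_le (R : realType) (rho C C' : R) f : C <= C' ->
  class_F rho C f -> class_F rho C' f.
Proof.
by move=> CC' [fp [tcd f1 f2]]; split => //; split => //; exact: le_trans CC'.
Qed.

(** Since x^2 is a multiple of log s, the Gaussian factor is a power of s, of an
exponent proportional to c2 K^2. A moment of order q + 1 beats it as soon as q
exceeds that exponent; the extra factor s pays for the constants. *)
Lemma moment_tail_le_gaussian (R : realType) (c2 K L' B s : R) (q : nat) :
  0 < c2 -> 0 < K -> 0 < L' -> 0 <= B ->
  c2 * K ^+ 2 * 10 <= q%:R -> expR 1 <= s -> B * (L' / K) ^+ q.+1 <= s ->
  forall x, K <= x -> x ^+ 2 = K ^+ 2 * (10 * ln s) ->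
  B / (s * x / L') ^+ q.+1 <= expR (- c2 * x ^+ 2).
Proof.
move=> c20 K0 L0 B0 cq s1 Bs x Kx x2.
have s0 : 0 < s by apply: lt_le_trans s1; exact: expR_gt0.
have x0 : 0 < x by exact: lt_le_trans Kx.
have lns : 0 <= ln s.
  rewrite ln_ge0//; apply: le_trans s1.
  by rewrite -[leLHS]expR0 ler_expR.
have sq : s ^- q = expR (- (q%:R * ln s)).
  by rewrite expRN expRM_natl lnK// posrE.
apply: (@le_trans _ _ (s ^- q)); last first.
  rewrite sq ler_expR mulNr lerN2 x2 [X in X <= _](_ : _ = c2 * K ^+ 2 * 10 * ln s).
    by rewrite ler_wpM2r.
  by ring.
rewrite ler_pdivrMr ?exprn_gt0 ?divr_gt0 ?mulr_gt0//.
have -> : s ^- q * (s * x / L') ^+ q.+1 = s * (x / L') ^+ q.+1.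
  by rewrite -mulrA exprMn exprSr !mulrA mulVf ?mul1r// expf_neq0// gt_eqF.
apply: (@le_trans _ _ (s * (K / L') ^+ q.+1)); last first.
  rewrite ler_wpM2l ?(ltW s0)// lerXn2r// ?nnegrE ?divr_ge0 ?(ltW K0) ?(ltW L0) ?(ltW x0)//.
  by rewrite ler_wpM2r// invr_ge0 ltW.
rewrite -ler_pdivrMr ?exprn_gt0 ?divr_gt0//.
by rewrite -exprVn invf_div.
Qed.

(** For a sample size at which the bias is below [x / 3], a deviation larger than
[x] makes the linear or the quadratic noise sum exceed its share [x / 3]. *)
Lemma deviation_prob_le (R : realType) (tau0 rho C0 D1 s x : R)
    (mu : probability (measurableTypeR R) R) (n J p : nat)
    (h : nat -> nat -> R) (d : measure_display) (Om : measurableType d)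
    (P : probability Om R) (theta : 'I_J -> {RV P >-> R})
    (eps : 'I_n -> 'I_J -> {RV P >-> R}) (f : 'I_J -> R -> R) (j : 'I_J) (t : R)
    (est : 'M[R]_(n, J) -> R) :
  let L := error_gain tau0 rho in
  0 < tau0 -> tau0 < 1 / 4 -> 0 < rho -> 0 < D1 -> 0 <= C0 ->
  weights h -> condC1 h -> condC3 h D1 ->
  (0 < n)%N -> 1 <= s -> s ^+ 10 = n%:R -> 0 < x ->
  L * (bias_const C0 D1 / s) <= x / 3 ->
  shift_noise_model mu theta eps -> (forall l, class_F rho C0 (f l)) ->
  shift_set tau0 t ->
  (forall y, argmax (shift_set tau0) (criterion (h n) y j) (est y)) ->
  measurable_fun [set: Om]
    (fun w => est (observations f (fix_shift theta j t) eps w)) ->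
  (cond_prob_shift P theta j t (deviation_event f eps est j x) <=
   (2 * expR (- (72 * L ^+ 2 * coef_mass C0 ^+ 2)^-1 * x ^+ 2) +
    (2 * p)`!%:R * (2 * expR 2) / (s * x / (3 * L * (1 + D1))) ^+ p)%:E)%E.
Proof.
move=> L t0 t4 rho0 D0 C_ge0 hw C1 C3 n1 s1 sn x0 bias_le model Ff th est_argmax mest.
have L0 : 0 < L.
  by rewrite divr_gt0// mulr_gt0// sin_coercivity_gt0.
have D11 : 0 < 1 + D1 by rewrite addr_gt0.
have s_gt0 : 0 < s by exact: lt_le_trans s1.
pose A1 := coef_mass C0.
have A10 : 0 < A1 by rewrite /A1 /coef_mass; lra.
have [M M1 hM] := weight_support C1 n1.
have [H1 H01] := hw n n1.
have H0 k : (1 <= k)%N -> 0 <= h n k by move=> /H01/andP[].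
have HC3 : \sum_(1 <= k < M) h n k * freq R k ^+ 4 <= D1 * n%:R.
  rewrite -(sum1_finite (u := fun k => h n k * freq R k ^+ 4)) ?C3// => k Mk.
  by rewrite hM// mul0r.
have [S1 _] := weight_sum_le H01 s_gt0 sn HC3.
pose Z phi k w := \sum_(i < n) noise_coef phi k i * eps i j w.
have sgZ phi k : subgaussian P (Z phi k).
  by apply: (noise_subgaussian j model); exact: noise_coef_sqr_le1.
pose z k w := `|Z 0 k w| + `|Z (pi / 2) k w|.
have mz k : measurable_fun setT (z k).
  by apply: measurable_funD; apply: measurableT_comp => //; exact: (sgZ _ k).1.
pose W1 w := \sum_(1 <= k < M) h n k * (k%:R * `|fcoef (f j) k|) * z k w.
pose W2 w := \sum_(1 <= k < M) h n k * k%:R * z k w ^+ 2.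
pose m1 := x / (3 * L * A1); pose m2 := s * x / (3 * L * (1 + D1)).
pose E1 := [set w | A1 * m1 < W1 w].
pose E2 := [set w | (1 + D1) * s ^+ 4 * m2 < W2 w].
have PE1 : (P E1 <= (2 * expR (- (72 * L ^+ 2 * A1 ^+ 2)^-1 * x ^+ 2))%:E)%E.
  rewrite (_ : - _ * x ^+ 2 = - (m1 ^+ 2 / 8)); last first.
    by rewrite /m1; field; rewrite !gt_eqF.
  apply: (@linear_tail _ _ _ P M (fun k => h n k * (k%:R * `|fcoef (f j) k|))
    (Z 0) (Z (pi / 2))) => //.
  - by move=> k k1; rewrite mulr_ge0 ?H0// mulr_ge0.
  - apply: le_trans (sum_abs_fcoef_le M (Ff j)).
    rewrite big_nat [leRHS]big_nat; apply: ler_sum => k /andP[k1 _].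
    by rewrite ler_piMl ?mulr_ge0//; case/andP: (H01 k k1).
  - by rewrite divr_gt0// mulr_gt0// mulr_gt0.
have PE2 : (P E2 <= ((2 * p)`!%:R * (2 * expR 2) / m2 ^+ p)%:E)%E.
  apply: (@quadratic_tail _ _ _ P M (fun k => h n k * k%:R) (Z 0) (Z (pi / 2))) => //.
  - by rewrite mulr_gt0 ?exprn_gt0.
  - by move=> k k1; rewrite mulr_ge0 ?H0.
  - by rewrite divr_gt0//; [rewrite mulr_gt0|rewrite mulr_gt0// mulr_gt0].
have mE1 : measurable E1.
  by apply: measurable_gt_set; apply: measurable_sum => k; exact: measurable_funM.
have mE2 : measurable E2.
  apply: measurable_gt_set; apply: measurable_sum => k; apply: measurable_funM => //.
  exact: measurable_funX.
have fixE w : fix_shift theta j t j w = t by rewrite /fix_shift eqxx.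
rewrite /cond_prob_shift; set E := deviation_event _ _ _ _ _ _.
have mE : measurable E.
  rewrite /E /deviation_event; under eq_set do rewrite fixE.
  apply: measurable_gt_set; apply: measurable_funM => //.
  apply: measurableT_comp => //.
  by apply: measurable_funB.
have sub : E `<=` E1 `|` E2.
  move=> w; rewrite /E /deviation_event /= fixE => xE.
  have [thE maxE] := est_argmax (observations f (fix_shift theta j t) eps w).
  set tau := est _ in xE thE maxE.
  have := @scaled_error_le R tau0 rho C0 D1 s (f j) n (h n) M (fun i => eps i j w)
    t tau (Ff j) C_ge0 rho0 t0 t4 D0 thE th n1 s1 sn M1 H1 H01 HC3.
  have critE u : criterion (h n) (observations f (fix_shift theta j t) eps w) j u =
     \sum_(1 <= k < M) h n k * (n%:R^-1 * \sum_(i < n) cos (freq R k * (design R i - u)) *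
       (f j (design R i - t) + eps i j w)) ^+ 2.
    rewrite /criterion (sum1_finite (M := M)); last by move=> k Mk; rewrite hM// mul0r.
    apply: eq_bigr => k _; congr (_ * (_ * _) ^+ 2); apply: eq_bigr => i _.
    by rewrite mxE fixE.
  rewrite -!critE => /(_ (maxE t th)) dle.
  have {dle} := lt_le_trans xE dle; rewrite -/L -/(W1 w) -/(W2 w) => xle.
  apply: contrapT => /not_orP[/negP nE1 /negP nE2].
  move: nE1 nE2; rewrite -!leNgt => nE1 nE2.
  have W1le : L * W1 w <= x / 3.
    apply: (le_trans (ler_wpM2l (ltW L0) nE1)).
    rewrite le_eqVlt; apply/orP; left; apply/eqP.
    by rewrite /m1; field; rewrite !gt_eqF.
  have W2le : L * (W2 w / s ^+ 5) <= x / 3.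
    rewrite mulrA ler_pdivrMr ?exprn_gt0//.
    apply: (le_trans (ler_wpM2l (ltW L0) nE2)).
    rewrite le_eqVlt; apply/orP; left; apply/eqP.
    by rewrite /m2; field; rewrite !gt_eqF.
  by move: xle; rewrite !mulrDr; lra.
have PE : (P E <= P (E1 `|` E2))%E.
  have mU := measurableU _ _ mE1 mE2.
  by apply: le_measure => //; exact: mem_set.
apply: (le_trans PE); apply: (le_trans (measureU2 P mE1 mE2)).
by apply: (le_trans (leeD PE1 PE2)); rewrite -EFinD lee_fin.
Qed.

Theorem lemma2p3 (R : realType) (tau0 rho C0 D1 rho1 : R)
    (mu : probability (measurableTypeR R) R)
    (J : nat -> nat) (h : nat -> nat -> R)
    (J_ge1 : forall n, (1 <= n)%N -> (1 <= J n)%N)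
    (tau0_gt0 : 0 < tau0) (tau0_lt : tau0 < 1 / 4)
    (A1 : supp mu `<=` shift_set tau0)
    (rho_gt0 : 0 < rho)
    (D1_gt0 : 0 < D1) (rho1_gt0 : 0 < rho1)
    (hw : weights h)
    (C1 : condC1 h) (C2 : condC2 h rho1) (C3 : condC3 h D1)
    (T : condT h (class_F rho C0)) :
  exists c1 c2 : R, [/\ 0 < c1, 0 < c2 &
    forall K : R, 0 < K -> exists N : nat, forall n : nat, (N <= n)%N ->
    forall (d : measure_display) (Om : measurableType d)
      (P : probability Om R)
      (theta : 'I_(J n) -> {RV P >-> R})
      (eps : 'I_n -> 'I_(J n) -> {RV P >-> R})
      (f : 'I_(J n) -> R -> R) (j : 'I_(J n)) (t : R)
      (est : 'M[R]_(n, J n) -> R),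
    shift_noise_model mu theta eps ->
    (forall l, class_F rho C0 (f l)) ->
    shift_set tau0 t ->
    (forall y, argmax (shift_set tau0) (criterion (h n) y j) (est y)) ->
    measurable_fun [set: Om]
      (fun w => est (observations f (fix_shift theta j t) eps w)) ->
    (cond_prob_shift P theta j t (deviation_event f eps est j (xn K n))
     <= (c1 * expR (- c2 * xn K n ^+ 2))%:E)%E].
Proof.
(* the class grows with the bound on the second derivative, which may thus be
   assumed nonnegative *)
pose C := `|C0|; have C_ge0 : 0 <= C by exact: normr_ge0.
have kap0 := sin_coercivity_gt0 tau0_gt0 tau0_lt.
pose L := error_gain tau0 rho.
have L0 : 0 < L by rewrite divr_gt0// mulr_gt0.
pose mass := coef_mass C.
have mass0 : 0 < mass by rewrite /mass /coef_mass; lra.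
pose B0 := bias_const C D1.
have B00 : 0 <= B0.
  rewrite /B0 /bias_const /alias_const.
  by rewrite addr_ge0// mulr_ge0 ?sqr_ge0 ?(ltW D1_gt0)//; lra.
pose c2 := (72 * L ^+ 2 * mass ^+ 2)^-1.
have c20 : 0 < c2 by rewrite invr_gt0 mulr_gt0 ?exprn_gt0// mulr_gt0 ?exprn_gt0.
exists 3, c2; split => // K K0.
pose L' := 3 * L * (1 + D1).
have L'0 : 0 < L' by rewrite mulr_gt0 ?addr_gt0// mulr_gt0.
pose q := Num.bound (c2 * K ^+ 2 * 10).
have cq : c2 * K ^+ 2 * 10 <= q%:R.
  by rewrite ltW// archi_boundP// mulr_ge0// mulr_ge0 ?sqr_ge0// ltW.
pose B : R := (2 * q.+1)`!%:R * (2 * expR 2).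
have Bge0 : 0 <= B by rewrite mulr_ge0// mulr_ge0// expR_ge0.
(* above s0 the logarithm of s is at least 1, the bias is at most x / 3, and
   the quadratic tail is dominated *)
pose s0 := expR 1 + 3 * L * B0 / K + B * (L' / K) ^+ q.+1.
have s01 : 0 <= 3 * L * B0 / K.
  by rewrite divr_ge0 ?(ltW K0)// mulr_ge0// mulr_ge0// ltW.
have s02 : 0 <= B * (L' / K) ^+ q.+1.
  by rewrite mulr_ge0// exprn_ge0// divr_ge0// ltW.
have e1 : 1 <= expR 1 :> R by rewrite -[leLHS]expR0 ler_expR.
have s0_ge1 : 1 <= s0 by rewrite /s0; lra.
have s0_ge0 : 0 <= s0 by exact: le_trans s0_ge1.
exists (Num.bound (s0 ^+ 10)) => n nN d Om P theta eps f j t est model Ff.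
move=> th est_argmax mest.
have {}Ff l : class_F rho C (f l) by exact: class_F_le (ler_norm C0) (Ff l).
have n_gt : s0 ^+ 10 < n%:R.
  by apply: lt_le_trans (archi_boundP _) _; rewrite ?exprn_ge0// ler_nat.
have n_gt0 : 0 < n%:R :> R by apply: le_lt_trans n_gt; rewrite exprn_ge0.
have n1 : (0 < n)%N by rewrite -(ltr0n R).
pose s := expR (ln n%:R / 10) : R.
have sn : s ^+ 10 = n%:R.
  by rewrite /s -expRM_natl mulrC divfK// lnK// posrE.
have s0s : s0 <= s.
  rewrite leNgt; apply/negP => ss0; have : s ^+ 10 <= s0 ^+ 10.
    by rewrite lerXn2r// ?nnegrE ?expR_ge0// ltW.
  by rewrite sn leNgt n_gt.
have es : expR 1 <= s by apply: le_trans s0s; rewrite /s0; lra.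
have s1 : 1 <= s by exact: le_trans es.
have s_gt0 : 0 < s by exact: lt_le_trans s1.
have lnn : ln n%:R = 10 * ln s by rewrite /s expRK; field.
have lns1 : 1 <= ln s by rewrite -(expRK 1) ler_ln ?posrE ?expR_gt0.
set x := xn K n.
have x2 : x ^+ 2 = K ^+ 2 * (10 * ln s).
  by rewrite /x /xn exprMn sqr_sqrtr lnn//; lra.
have Kx : K <= x.
  rewrite /x /xn ler_peMr ?(ltW K0)//.
  by rewrite -[leLHS]sqrtr1 ler_sqrt lnn; lra.
have x0 : 0 < x by exact: lt_le_trans Kx.
have bias_le : L * (B0 / s) <= x / 3.
  have sK : 3 * L * B0 / K <= s by apply: le_trans s0s; rewrite /s0; lra.
  rewrite mulrA ler_pdivrMr// [leRHS]mulrAC ler_pdivlMr//.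
  apply: (@le_trans _ _ (K * s)); last by rewrite ler_wpM2r// ltW.
  by move: sK; rewrite ler_pdivrMr//; lra.
apply: le_trans (deviation_prob_le q.+1 tau0_gt0 tau0_lt rho_gt0 D1_gt0 C_ge0
  hw C1 C3 n1 s1 sn x0 bias_le model Ff th est_argmax mest) _.
rewrite lee_fin -/L -/mass -/c2 -/L' -/B.
have Bs : B * (L' / K) ^+ q.+1 <= s by apply: le_trans s0s; rewrite /s0; lra.
have := moment_tail_le_gaussian c20 K0 L'0 Bge0 cq es Bs Kx x2.
by lra.
Qed.
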